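(* Let $(M^n,g,u,\lambda)$, $n\ge 2$, be a nontrivial compact $m$-quasi-Einstein manifold with (non-empty) boundary, with $m>1$ and constant scalar curvature $R$. Then $$R\in\left\{\frac{k(m-n)+n(n-1)}{m+n-k-1}\,\lambda\ ;\ k\in\{0,1,\ldots,n-1\}\right\}.$$
   Context: A compact $n$-dimensional Riemannian manifold $(M^n,g)$, $n\ge 2$, possibly with boundary $\partial M$, is an $m$-quasi-Einstein manifold $(M^n,g,u,\lambda)$ if there is a smooth function $u$ on $M$ with $\nabla^2 u=\frac{u}{m}(Ric-\lambda g)$ in $M$, $u>0$ on the interior of $M$, and $u=0$ on $\partial M$, for some constants $\lambda\in\mathbb{R}$ and $0<m<\infty$ (when $m=1$ one assumes in addition $\Delta u=-\lambda u$). Here $\nabla^2u$ is the Hessian of $u$, $Ric$ is the Ricci tensor of $g$, and $R$ is the scalar curvature. It is called trivial if $u$ is constant, and nontrivial otherwise. ''With boundary'' means $\partial M\neq\emptyset$. *)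

(* Defs.v *)
From mathcomp Require Export all_boot all_order all_algebra.
From mathcomp Require Export all_classical all_reals all_analysis.
Export Order.TTheory GRing.Theory Num.Theory numFieldNormedType.Exports.

Set Implicit Arguments.
Unset Strict Implicit.
Unset Printing Implicit Defensive.

Global Open Scope classical_set_scope.
Global Open Scope ring_scope.

(* The half-space { x | 0 <= x_0 } of R^n; the quantifier over indices of value
   0 avoids requiring n to be syntactically a successor. *)
Definition halfspace (R : realType) (n : nat) : set 'rV[R]_n :=
  [set x | forall a : 'I_n, val a = 0%N -> 0 <= x 0 a].

Definition basis_vector (R : realType) (n : nat) (a : 'I_n) : 'rV[R]_n :=
  delta_mx 0 a.

Definition iterated_partial (R : realType) (n : nat) (s : seq 'I_n)
    (f : 'rV[R]_n -> R) : 'rV[R]_n -> R :=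
  foldr (fun a h x => 'D_(basis_vector R a) h x) f s.

(* C^oo on an arbitrary subset D of R^n: locally the restriction of a function
   that is C^oo on an open set. For D relatively open in the half-space this is
   smoothness up to the boundary. *)
Definition smooth_on (R : realType) (n : nat) (D : set 'rV[R]_n)
    (f : 'rV[R]_n -> R) : Prop :=
  forall x, D x -> exists (W : set 'rV[R]_n) (F : 'rV[R]_n -> R),
    [/\ open W, W x,
        forall (s : seq 'I_n) y, W y -> differentiable (iterated_partial s F) y
      & forall y, W y -> D y -> F y = f y].

(* Partial derivative at x relative to D: the increment h is restricted to
   x + h e_a in D. It is the usual partial derivative at interior points of D,
   and one-sided in the normal direction at points of the boundary hyperplane. *)
Definition partial (R : realType) (n : nat) (D : set 'rV[R]_n) (a : 'I_n)
    (f : 'rV[R]_n -> R) (x : 'rV[R]_n) : R :=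
  lim ((fun h : R => h^-1 * (f (x + h *: basis_vector R a) - f x)) @
       within [set h : R | D (x + h *: basis_vector R a)] (0 : R)^').

(* Smooth n-manifold with (possibly empty) boundary on the space M, given by a
   smooth atlas of charts [coord i : dom i -> halfspace] with inverses [param i];
   the atlas is not required to be maximal. *)
Record smooth_manifold (R : realType) (n : nat) (M : topologicalType) := {
  idx : Type;
  dom : idx -> set M;
  coord : idx -> M -> 'rV[R]_n;
  param : idx -> 'rV[R]_n -> M;
  mfd_hausdorff : hausdorff_space M;
  mfd_second_countable : @second_countable M;
  dom_open : forall i, open (dom i);
  dom_cover : forall p, exists i, dom i p;
  coord_image : forall i, exists2 O : set 'rV[R]_n,
    open O & coord i @` dom i = O `&` @halfspace R n;
  coordK : forall i p, dom i p -> param i (coord i p) = p;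
  coord_continuous : forall i, {within dom i, continuous (coord i)};
  param_continuous : forall i, {within coord i @` dom i, continuous (param i)};
  transition_smooth : forall i j (a : 'I_n),
    smooth_on (coord i @` (dom i `&` dom j))
              (fun x => coord j (param i x) 0 a) }.

Arguments idx {R n M} A : rename.
Arguments dom {R n M} A i : rename.
Arguments coord {R n M} A i : rename.
Arguments param {R n M} A i : rename.

Definition chart_image (R : realType) (n : nat) (M : topologicalType)
    (A : smooth_manifold R n M) (i : idx A) : set 'rV[R]_n :=
  coord A i @` dom A i.

Definition mboundary (R : realType) (n : nat) (M : topologicalType)
    (A : smooth_manifold R n M) : set M :=
  [set p | exists2 i : idx A, dom A i p &
           exists2 a : 'I_n, val a = 0%N & coord A i p 0 a = 0].

Definition minterior (R : realType) (n : nat) (M : topologicalType)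
    (A : smooth_manifold R n M) : set M := ~` mboundary A.

(* Row a, column b is d y_b / d x_a for the change of coordinates y = y(x) from
   chart i to chart j. *)
Definition transition_jacobian (R : realType) (n : nat) (M : topologicalType)
    (A : smooth_manifold R n M) (i j : idx A) (x : 'rV[R]_n) : 'M[R]_n :=
  \matrix_(a, b) partial (coord A i @` (dom A i `&` dom A j)) a
                   (fun y => coord A j (param A i y) 0 b) x.

Definition smooth_function (R : realType) (n : nat) (M : topologicalType)
    (A : smooth_manifold R n M) (u : M -> R) : Prop :=
  forall i : idx A, smooth_on (chart_image i) (u \o param A i).

(* A Riemannian metric is given by its components in the charts of the atlas;
   [metric_change] is the tensoriality of these components. *)
Record riemannian_metric (R : realType) (n : nat) (M : topologicalType)
    (A : smooth_manifold R n M) := {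
  gmx :> idx A -> 'rV[R]_n -> 'M[R]_n;
  metric_smooth : forall i (a b : 'I_n),
    smooth_on (chart_image i) (fun x => gmx i x a b);
  metric_sym : forall i x, chart_image i x -> (gmx i x)^T = gmx i x;
  metric_pos : forall i x, chart_image i x ->
    forall v : 'rV[R]_n, v != 0 -> 0 < (v *m gmx i x *m v^T) 0 0;
  metric_change : forall i j p, dom A i p -> dom A j p ->
    gmx i (coord A i p) =
      transition_jacobian i j (coord A i p) *m gmx j (coord A j p)
        *m (transition_jacobian i j (coord A i p))^T }.

(* Gamma^c_{ab} *)
Definition christoffel (R : realType) (n : nat) (M : topologicalType)
    (A : smooth_manifold R n M) (g : riemannian_metric A) (i : idx A)
    (c a b : 'I_n) (x : 'rV[R]_n) : R :=
  2^-1 * \sum_(d < n) invmx (g i x) c d *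
    (partial (chart_image i) a (fun y => g i y b d) x
     + partial (chart_image i) b (fun y => g i y a d) x
     - partial (chart_image i) d (fun y => g i y a b) x).

(* The component along d_d of
   R(d_a, d_b) d_c = nabla_a nabla_b d_c - nabla_b nabla_a d_c. *)
Definition riemann (R : realType) (n : nat) (M : topologicalType)
    (A : smooth_manifold R n M) (g : riemannian_metric A) (i : idx A)
    (a b c d : 'I_n) (x : 'rV[R]_n) : R :=
  partial (chart_image i) a (christoffel g i d b c) x
  - partial (chart_image i) b (christoffel g i d a c) x
  + \sum_(e < n) (christoffel g i d a e x * christoffel g i e b c x
                  - christoffel g i d b e x * christoffel g i e a c x).

(* Ric(Y, Z) = tr (X |-> R(X, Y) Z), nonnegative on round spheres. *)
Definition ricci (R : realType) (n : nat) (M : topologicalType)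
    (A : smooth_manifold R n M) (g : riemannian_metric A) (i : idx A)
    (x : 'rV[R]_n) : 'M[R]_n :=
  \matrix_(b, c) \sum_(a < n) riemann g i a b c a x.

Definition hessian (R : realType) (n : nat) (M : topologicalType)
    (A : smooth_manifold R n M) (g : riemannian_metric A) (u : M -> R)
    (i : idx A) (x : 'rV[R]_n) : 'M[R]_n :=
  \matrix_(a, b)
    (partial (chart_image i) a (partial (chart_image i) b (u \o param A i)) x
     - \sum_(c < n) christoffel g i c a b x
                    * partial (chart_image i) c (u \o param A i) x).

Definition metric_trace (R : realType) (n : nat) (M : topologicalType)
    (A : smooth_manifold R n M) (g : riemannian_metric A) (i : idx A)
    (T : 'rV[R]_n -> 'M[R]_n) (x : 'rV[R]_n) : R :=
  \sum_(a < n) \sum_(b < n) invmx (g i x) a b * T x a b.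

Definition scalar_curvature (R : realType) (n : nat) (M : topologicalType)
    (A : smooth_manifold R n M) (g : riemannian_metric A) (i : idx A)
    (x : 'rV[R]_n) : R :=
  metric_trace g i (ricci g i) x.

Definition laplacian (R : realType) (n : nat) (M : topologicalType)
    (A : smooth_manifold R n M) (g : riemannian_metric A) (u : M -> R)
    (i : idx A) (x : 'rV[R]_n) : R :=
  metric_trace g i (hessian g u i) x.

Definition has_constant_scalar_curvature (R : realType) (n : nat)
    (M : topologicalType) (A : smooth_manifold R n M)
    (g : riemannian_metric A) (S : R) : Prop :=
  forall (i : idx A) p, dom A i p -> scalar_curvature g i (coord A i p) = S.

(* Compact m-quasi-Einstein manifold (M, g, u, lambda), possibly with boundary.
   Connectedness is not part of the definition. *)
Definition quasi_einstein (R : realType) (n : nat) (M : topologicalType)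
    (A : smooth_manifold R n M) (g : riemannian_metric A) (m : R) (u : M -> R)
    (lambda : R) : Prop :=
  [/\ compact [set: M] /\ 0 < m,
      smooth_function A u,
      forall (i : idx A) p, dom A i p ->
        hessian g u i (coord A i p) =
          (u p / m) *: (ricci g i (coord A i p)
                        - lambda *: g i (coord A i p)),
      (forall p, minterior A p -> 0 < u p) /\
      (forall p, mboundary A p -> u p = 0)
    & m = 1 -> forall (i : idx A) p, dom A i p ->
        laplacian g u i (coord A i p) = - lambda * u p].

Definition trivial_potential (R : realType) (M : Type) (u : M -> R) : Prop :=
  exists c : R, forall p, u p = c.

(* Main.v *)
From HB Require Import structures.
Require Import Defs.
From mathcomp Require Import ring lra.

(* Write w = du, H = Hess u, and K, q for the (1,1)-tensors of H and Ric, so that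
   m K = u (q - lambda I).  Commuting covariant derivatives gives
   div K = d tr K + q w, and the contracted Bianchi identity gives
   2 div q = dS = 0; taking the divergence of m K = u (q - lambda I) therefore
   yields (m - 1) q w = ((n - 1) lambda - S) w, i.e. K w = c u w with
   c = - (S + (m - n) lambda) / (m (m - 1)).  Differentiating this at a maximum
   point of u, where w = 0, gives K^2 = c u K, hence tr K = c u rank K, while
   m tr K = u (S - n lambda).  This is the claimed formula with
   k = n - rank K, provided that the rank is positive.

   If the rank is 0 then S = n lambda and K has trace 0 everywhere in the interior.
   The divergence of K (grad u) = c u grad u then gives tr K^2 = 0, so K = 0 because K
   is self-adjoint, and c u w = 0.  As u vanishes on the boundary and is positive
   inside, w <> 0 at some interior point near the boundary; so c = 0, which for
   S = n lambda means lambda = 0, and then S = 0 lies in the set as well.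

   In a chart the tensor calculus takes place in the commutative ring of functions that are
   smooth on an open set, equipped with the commuting derivations d/dx_a. *)

Set Implicit Arguments.
Unset Strict Implicit.
Unset Printing Implicit Defensive.

(** * Tensor calculus in a ring with commuting derivations *)

Section TensorCalculus.
Variables (A : comNzRingType) (n : nat) (d : 'I_n -> A -> A).
Hypothesis dD : forall a x y, d a (x + y) = d a x + d a y.
Hypothesis dM : forall a x y, d a (x * y) = d a x * y + x * d a y.
Hypothesis dC : forall a b x, d a (d b x) = d b (d a x).
Implicit Types (a b c e : 'I_n).

Lemma der0 a : d a 0 = 0.
Proof. by apply: (addrI (d a 0)); rewrite -dD !addr0. Qed.

Lemma derN a x : d a (- x) = - d a x.
Proof. by apply: (addrI (d a x)); rewrite -dD !subrr der0. Qed.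

Lemma derB a x y : d a (x - y) = d a x - d a y.
Proof. by rewrite dD derN. Qed.

Lemma der1 a : d a 1 = 0.
Proof. by apply: (addrI (d a 1)); rewrite addr0 -[in RHS](mulr1 1) dM mul1r mulr1. Qed.

Lemma der_nat a k : d a k%:R = 0.
Proof. by elim: k => [|k IH]; rewrite ?der0 // mulrS dD der1 IH addr0. Qed.

Lemma der_sum a (I : Type) (r : seq I) (P : pred I) (F : I -> A) :
  d a (\sum_(i <- r | P i) F i) = \sum_(i <- r | P i) d a (F i).
Proof. exact: (big_morph (d a) (dD a) (der0 a)). Qed.

Definition dmx a p q (X : 'M[A]_(p, q)) : 'M[A]_(p, q) := map_mx (d a) X.

Lemma dmxM a p q r (X : 'M[A]_(p, q)) (Y : 'M[A]_(q, r)) :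
  dmx a (X *m Y) = dmx a X *m Y + X *m dmx a Y.
Proof.
apply/matrixP => i j; rewrite !mxE der_sum -big_split /=.
by apply: eq_bigr => k _; rewrite dM !mxE.
Qed.

Lemma dmxD a p q (X Y : 'M[A]_(p, q)) : dmx a (X + Y) = dmx a X + dmx a Y.
Proof. by apply/matrixP => i j; rewrite !mxE dD. Qed.

Lemma dmxN a p q (X : 'M[A]_(p, q)) : dmx a (- X) = - dmx a X.
Proof. by apply/matrixP => i j; rewrite !mxE derN. Qed.

Lemma dmxC a b p q (X : 'M[A]_(p, q)) : dmx a (dmx b X) = dmx b (dmx a X).
Proof. by apply/matrixP => i j; rewrite !mxE dC. Qed.

Lemma dmx_tr a p q (X : 'M[A]_(p, q)) : dmx a X^T = (dmx a X)^T.
Proof. by apply/matrixP => i j; rewrite !mxE. Qed.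

(* [G a] is the matrix with (row c, column b) entry Gamma^c_{ab}, and [h] is the
   inverse metric. *)
Variables (G : 'I_n -> 'M[A]_n) (h : 'M[A]_n).
Hypothesis torsion_free : forall a b c, G a c b = G b c a.
Variable half : A.
Hypothesis half2 : half *+ 2 = 1.
Hypothesis h_sym : h^T = h.
(** Metric compatibility of the connection, stated for the inverse metric; the metric itself does
    not enter this section. *)
Hypothesis dh : forall a, dmx a h = - (G a *m h) - h *m (G a)^T.

(** The curvature of the connection [d + G]: entry (i, j) of [curv a b] is the component along d_i
    of R(d_a, d_b) d_j. In [curvU] the index j is raised, so that the skewness of the curvature
    endomorphism becomes skewness of a matrix. *)
Definition curv a b : 'M[A]_n :=
  dmx a (G b) - dmx b (G a) + (G a *m G b - G b *m G a).

Definition curvU a b : 'M[A]_n := curv a b *m h.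

Lemma curvN a b : curv b a = - curv a b.
Proof. by rewrite /curv !opprD !opprK addrC [in RHS]addrC; congr (_ + _); rewrite addrC. Qed.

Lemma curvE a b i j : curv a b i j = d a (G b i j) - d b (G a i j)
  + \sum_e (G a i e * G b e j - G b i e * G a e j).
Proof. by rewrite !mxE sumrB. Qed.

Lemma mxaddE p q (X Y : 'M[A]_(p, q)) i j : (X + Y) i j = X i j + Y i j.
Proof. by rewrite mxE. Qed.

Lemma mxoppE p q (X : 'M[A]_(p, q)) i j : (- X) i j = - X i j.
Proof. by rewrite mxE. Qed.

(** Covariant derivative of an endomorphism field. The form indices of [curv] receive no correction
    terms: in the cyclic sum of the Bianchi identity these would cancel. *)
Let D c X := dmx c X + G c *m X - X *m G c.

Lemma second_bianchi a b c :
  D c (curv a b) + D a (curv b c) + D b (curv c a) = 0.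
Proof.
rewrite /D /curv !(dmxD, dmxN, dmxM) (dmxC b a) (dmxC c a) (dmxC c b).
rewrite !(mulmxDl, mulmxDr, mulmxN, mulNmx, mulmxA).
by apply/matrixP => i j; rewrite !(mxaddE, mxoppE) [RHS]mxE; ring.
Qed.

(** Commute two derivations on [h]: substituting [dh] twice, the symmetric terms cancel and the
    curvature of [h], namely [curvU] plus its transpose, remains. *)
Lemma curvU_trans a b : (curvU a b)^T = - curvU a b.
Proof.
have tD (X Y : 'M[A]_n) : (X + Y)^T = X^T + Y^T by apply/matrixP=> i j; rewrite !mxE.
have tN (X : 'M[A]_n) : (- X)^T = - X^T by apply/matrixP=> i j; rewrite !mxE.
have := dmxC a b h; rewrite !dh !(dmxD, dmxN, dmxM) !dmx_tr !dh.
rewrite /curvU /curv trmx_mul h_sym !(tD, tN) !trmx_mul.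
rewrite !(mulmxDl, mulmxDr, mulmxN, mulNmx, mulmxA) => /matrixP H.
apply/matrixP => i j; have {H} := H i j.
rewrite !(mxaddE, mxoppE) => /eqP; rewrite -subr_eq0 => /eqP H.
apply/eqP; rewrite -subr_eq0 -oppr_eq0 -[X in _ == X]H; apply/eqP.
by ring.
Qed.

(** As [h] is parallel, raising an index commutes with covariant differentiation. *)
Lemma dh_curvU a b c : D c (curv a b) *m h =
  dmx c (curvU a b) + G c *m curvU a b + curvU a b *m (G c)^T.
Proof.
rewrite /D /curvU dmxM dh !(mulmxDl, mulmxDr, mulmxN, mulNmx, mulmxA).
by apply/matrixP => i j; rewrite !(mxaddE, mxoppE); ring.
Qed.

(** The Ricci tensor with its second index raised. *)
Definition ric a c : A := \sum_b curvU b a b c.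

(** The covariant divergence of a tensor with lower index [a] and upper index [c]. In the last term
    the names of the summation indices are exchanged and torsion-freeness is used, so that only
    [G a] occurs there. *)
Definition div (T : 'I_n -> 'I_n -> A) a : A :=
  \sum_c d c (T a c) + \sum_c \sum_e (G c c e * T a e - G a c e * T c e).

Lemma eq_opp0 (x : A) : x = - x -> x = 0.
Proof.
move=> xN; rewrite -(mulr1 x) -half2 mulrnAr -mulrnAl mulr2n {2}xN subrr.
by rewrite mul0r.
Qed.

Lemma skew_sum0 (F P : 'I_n -> 'I_n -> A) :
  (forall c e, F c e = F e c) -> (forall c e, P c e = - P e c) ->
  \sum_c \sum_e F c e * P c e = 0.
Proof.
move=> FC PN; apply: eq_opp0.
rewrite [in LHS]exchange_big -sumrN; apply: eq_bigr => c _.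
by rewrite -sumrN; apply: eq_bigr => e _; rewrite FC PN mulrN.
Qed.

(** Trace the second Bianchi identity twice. Of the three cyclic terms, [T1] and [T3] coincide and
    give the part of [div ric] without [G a]; [T2] gives minus the derivative of the scalar
    curvature and twice the missing [G a] part. *)
Lemma contracted_bianchi a : div ric a *+ 2 = d a (\sum_c ric c c).
Proof.
have Qs b c i j : curvU b c i j = - curvU c b i j.
  by rewrite /curvU curvN mulNmx mxoppE.
have Qt b c i j : curvU b c i j = - curvU b c j i.
  by have /matrixP/(_ j i) := curvU_trans b c; rewrite !mxE.
have ricE' b e : \sum_c curvU b c e c = ric b e.
  by apply: eq_bigr => c _; rewrite Qs Qt opprK.
pose E c a b := dmx c (curvU a b) + G c *m curvU a b + curvU a b *m (G c)^T.
have B b c : E c a b + E a b c + E b c a = 0.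
  by rewrite /E -!dh_curvU -!mulmxDl second_bianchi mul0mx.
have EE i j k l o : E i j k l o = d i (curvU j k l o)
    + \sum_e G i l e * curvU j k e o + \sum_e G i o e * curvU j k l e.
  rewrite /E !mxaddE !mxE; congr (_ + _).
  by apply: eq_bigr => e _; rewrite [_^T _ _]mxE mulrC.
have T1 : \sum_c \sum_b E c a b c b =
    \sum_c d c (ric a c) + \sum_c \sum_e G c c e * ric a e.
  under eq_bigr => c _ do [under eq_bigr => b _ do rewrite EE; rewrite !big_split].
  (* The remaining sum pairs Christoffel symbols, symmetric in their lower indices, with a curvature
     that is skew in the same indices. *)
  rewrite !big_split /= [X in _ + X]exchange_big [X in _ + X]big1 ?addr0.
    congr (_ + _); apply: eq_bigr => c _; first by rewrite -der_sum ricE'.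
    by rewrite exchange_big; apply: eq_bigr => e _; rewrite -mulr_sumr ricE'.
  by move=> b _; apply: skew_sum0.
have T2 : \sum_c \sum_b E a b c c b =
    - d a (\sum_c ric c c) - (\sum_c \sum_e G a c e * ric c e) *+ 2.
  under eq_bigr => c _ do [under eq_bigr => b _ do rewrite EE; rewrite !big_split].
  rewrite !big_split /= -addrA mulr2n opprD; congr (_ + (_ + _)).
  - rewrite der_sum -sumrN; apply: eq_bigr => c _.
    rewrite -der_sum -derN; congr (d _ _); rewrite -sumrN.
    by apply: eq_bigr => b _; rewrite Qt.
  - rewrite -sumrN; apply: eq_bigr => c _; rewrite exchange_big -sumrN.
    apply: eq_bigr => e _; rewrite -mulr_sumr -mulrN; congr (_ * _).
    by rewrite -sumrN; apply: eq_bigr => b _; rewrite Qt.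
  - rewrite exchange_big -sumrN; apply: eq_bigr => b _; rewrite exchange_big -sumrN.
    apply: eq_bigr => e _; rewrite -mulr_sumr -mulrN; congr (_ * _).
    by rewrite -sumrN; apply: eq_bigr => c _; rewrite Qs.
have T3 : \sum_c \sum_b E b c a c b =
    \sum_c d c (ric a c) + \sum_c \sum_e G c c e * ric a e.
  under eq_bigr => c _ do [under eq_bigr => b _ do rewrite EE; rewrite !big_split].
  rewrite !big_split /= [X in _ + X + _]big1 ?addr0.
    congr (_ + _); rewrite exchange_big; apply: eq_bigr => c _.
      by rewrite -der_sum.
    by rewrite exchange_big; apply: eq_bigr => e _; rewrite -mulr_sumr.
  by move=> c _; apply: skew_sum0.
have : \sum_c \sum_b (E c a b c b + E a b c c b + E b c a c b) = 0.
  rewrite big1 // => c _; rewrite big1 // => b _.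
  by have /matrixP/(_ c b) := B b c; rewrite !mxaddE [RHS]mxE.
under eq_bigr => c _ do rewrite !big_split /=.
rewrite !big_split /= T1 T2 T3 => T.
have divE : div ric a = \sum_c d c (ric a c)
    + (\sum_c \sum_e G c c e * ric a e - \sum_c \sum_e G a c e * ric c e).
  rewrite /div; congr (_ + _); rewrite -sumrB; apply: eq_bigr => c _.
  by rewrite -sumrB.
apply/eqP; rewrite -subr_eq0 -[X in _ == X]T divE; apply/eqP.
by rewrite !mulr2n; ring.
Qed.

(** The Ricci identity for a vector field [v]: [K] is its covariant derivative, the trace of [K] is
    its divergence, and exchanging the order of two covariant derivatives costs a curvature term. *)
Lemma div_covariant_derivative (v : 'cV[A]_n) (K := fun a c => (dmx a v + G a *m v) c 0) a :
  div K a = d a (\sum_c K c c) + \sum_c (curv c a *m v) c 0.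
Proof.
have KE b c : K b c = d b (v c 0) + (G b *m v) c 0 by rewrite /K mxaddE mxE.
have E c : (curv c a *m v) c 0 = d c (K a c) - d a (K c c)
    + \sum_e (G c c e * K a e - G a c e * K c e).
  rewrite sumrB !KE !dD [d c (d a _)]dC.
  have dG b e : d b ((G e *m v) c 0) = (dmx b (G e) *m v) c 0 + (G e *m dmx b v) c 0.
    by rewrite -mxaddE -dmxM [RHS]mxE.
  have GK b e : \sum_k G b c k * K e k = (G b *m dmx e v) c 0 + (G b *m G e *m v) c 0.
    rewrite -mulmxA -mxaddE -mulmxDr mxE; apply: eq_bigr => k _.
    by rewrite KE !mxE.
  by rewrite !dG !GK /curv !(mulmxDl, mulNmx) !(mxaddE, mxoppE); ring.
rewrite (eq_bigr _ (fun c _ => E c)) !big_split /= sumrN der_sum /div; ring.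
Qed.

Lemma div_scale u (T : 'I_n -> 'I_n -> A) a :
  div (fun b c => u * T b c) a = \sum_c d c u * T a c + u * div T a.
Proof.
rewrite /div mulrDr addrA; congr (_ + _).
  by rewrite mulr_sumr -big_split; apply: eq_bigr => c _; rewrite dM.
rewrite mulr_sumr; apply: eq_bigr => c _; rewrite mulr_sumr.
by apply: eq_bigr => e _; rewrite mulrBr; ring.
Qed.

Lemma div_sub (T U : 'I_n -> 'I_n -> A) a :
  div (fun b c => T b c - U b c) a = div T a - div U a.
Proof.
rewrite /div opprD addrACA; congr (_ + _).
  by rewrite -sumrB; apply: eq_bigr => c _; rewrite derB.
rewrite -sumrB; apply: eq_bigr => c _; rewrite -sumrB.
by apply: eq_bigr => e _; ring.
Qed.

(** The identity tensor is parallel: the two Christoffel terms cancel by torsion-freeness. *)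
Lemma div_delta a : div (fun b c => (b == c)%:R) a = 0.
Proof.
rewrite /div big1 ?add0r => [|c _]; last exact: der_nat.
rewrite big1 // => c _; rewrite sumrB (bigD1 a) //= eqxx mulr1 big1 => [|e ea].
  rewrite (bigD1 c) //= eqxx mulr1 big1 => [|e ec].
    by rewrite (torsion_free a c) !addr0 subrr.
  by rewrite eq_sym (negPf ec) mulr0.
by rewrite eq_sym (negPf ea) mulr0.
Qed.

Variable u : A.
Let w : 'cV[A]_n := \col_a d a u.
Let v : 'cV[A]_n := h *m w.

Definition hess a b : A := d a (d b u) - \sum_e G a e b * d e u.
(** The Hessian with its second index raised, written as the covariant derivative of the gradient
    [v] so that [div_covariant_derivative] applies to it; [hessUE] recovers the usual form. *)
Definition hessU a c : A := (dmx a v + G a *m v) c 0.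

Lemma hess_sym a b : hess a b = hess b a.
Proof.
by rewrite /hess dC; congr (_ - _); apply: eq_bigr => e _; rewrite torsion_free.
Qed.

Lemma hessUE a c : hessU a c = \sum_b hess a b * h b c.
Proof.
rewrite /hessU /v dmxM dh mulmxBl mulNmx !mulmxA.
have -> : - (G a *m h *m w) - h *m (G a)^T *m w + h *m dmx a w + G a *m h *m w
    = h *m (dmx a w - (G a)^T *m w).
  rewrite mulmxBr mulmxA; apply/matrixP => i j; rewrite !(mxaddE, mxoppE); ring.
rewrite mxE; apply: eq_bigr => b _; rewrite mulrC -[in RHS]h_sym [h^T _ _]mxE.
rewrite mxaddE mxoppE !mxE; congr ((_ - _) * _).
by apply: eq_bigr => e _; rewrite !mxE.
Qed.

Lemma curv_grad a : \sum_c (curv c a *m v) c 0 = \sum_e ric a e * d e u.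
Proof.
under [RHS]eq_bigr => e _ do rewrite /ric mulr_suml.
rewrite exchange_big; apply: eq_bigr => c _; rewrite /v mulmxA mxE.
by apply: eq_bigr => e _; rewrite [w _ _]mxE.
Qed.

(** Bochner's formula. *)
Lemma div_hessU a :
  div hessU a = d a (\sum_c hessU c c) + \sum_e ric a e * d e u.
Proof. by rewrite div_covariant_derivative curv_grad. Qed.

Lemma hessU_grad a : \sum_c hessU a c * d c u = \sum_b hess a b * v b 0.
Proof.
under eq_bigr => c _ do rewrite hessUE mulr_suml.
rewrite exchange_big; apply: eq_bigr => b _; rewrite /v mxE mulr_sumr.
by apply: eq_bigr => c _; rewrite !mxE mulrA.
Qed.

(** * Consequences of the quasi-Einstein equation when the scalar curvature is constant *)

Section ConstantScalarCurvature.
Variables m lam s : A.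
Hypothesis dm : forall a, d a m = 0.
Hypothesis dlam : forall a, d a lam = 0.
Hypothesis ds : forall a, d a s = 0.
Hypothesis qe : forall a c, m * hessU a c = u * (ric a c - lam * (a == c)%:R).
Hypothesis scal : \sum_c ric c c = s.

Lemma qe_laplacian : m * (\sum_c hessU c c) = u * (s - n%:R * lam).
Proof.
rewrite mulr_sumr; under eq_bigr => c _ do rewrite qe eqxx mulr1.
by rewrite -mulr_sumr sumrB scal sumr_const card_ord mulr_natl.
Qed.

(** Take the divergence of both sides of [qe]. The left side is (s - n lam) du + m ric(du) by
    Bochner's formula and the traced equation; the right side is ric(du) - lam du, since [ric] is
    divergence-free for constant [s]. *)
Lemma qe_ric_grad a :
  (m - 1) * (\sum_c ric a c * d c u) = ((n%:R - 1) * lam - s) * d a u.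
Proof.
have div0 : div ric a = 0.
  apply: eq_opp0; apply/eqP; rewrite -addr_eq0 -mulr2n contracted_bianchi.
  by rewrite scal ds.
have : m * div hessU a = \sum_c ric a c * d c u - lam * d a u.
  transitivity (div (fun b c => u * (ric b c - lam * (b == c)%:R)) a).
    transitivity (div (fun b c => m * hessU b c) a).
      by rewrite div_scale big1 ?add0r // => c _; rewrite dm mul0r.
    by rewrite /div; congr (_ + _); apply: eq_bigr => c _;
      rewrite ?qe //; apply: eq_bigr => e _; rewrite !qe.
  have dlam0 : div (fun b c => lam * (b == c)%:R) a = 0.
    by rewrite div_scale div_delta mulr0 addr0 big1 // => c _; rewrite dlam mul0r.
  rewrite div_scale div_sub div0 dlam0 subrr mulr0 addr0.
  under eq_bigr => c _ do rewrite mulrBr.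
  rewrite sumrB; congr (_ - _); first by apply: eq_bigr => c _; rewrite mulrC.
  rewrite (bigD1 a) //= eqxx mulr1 mulrC big1 ?addr0 // => c ca.
  by rewrite eq_sym (negPf ca) !mulr0.
rewrite div_hessU mulrDr.
have <- : d a (m * \sum_c hessU c c) = m * d a (\sum_c hessU c c).
  by rewrite dM dm mul0r add0r.
rewrite qe_laplacian dM derB ds dM der_nat dlam mulr0 mul0r addr0 subr0 mulr0 addr0.
move=> E; rewrite mulrBl mul1r.
apply/eqP; rewrite -subr_eq0; move/eqP: E; rewrite -subr_eq0 => /eqP E.
by rewrite -[X in _ == X]E; apply/eqP; ring.
Qed.

Lemma qe_hess_grad a :
  m * (m - 1) * (\sum_c hessU a c * d c u)
  = - (s + (m - n%:R) * lam) * (u * d a u).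
Proof.
have mK : m * (\sum_c hessU a c * d c u) = 
    u * (\sum_c ric a c * d c u) - lam * (u * d a u).
  rewrite !mulr_sumr; under eq_bigr => c _ do rewrite mulrA qe -mulrA mulrBl mulrBr.
  rewrite sumrB; congr (_ - _).
  rewrite (bigD1 a) //= eqxx mulr1 mulrCA big1 ?addr0 // => c ca.
  by rewrite eq_sym (negPf ca) !(mulr0, mul0r).
rewrite mulrAC mK; have := qe_ric_grad a.
move: (\sum_c ric a c * _) => X HX.
rewrite (_ : (u * X - _) * _ = u * ((m - 1) * X) - lam * (u * d a u) * (m - 1)); last by ring.
by rewrite HX; ring.
Qed.

(* Divergence of [hessU v = k u v], the gradient being an eigenvector. *)
Lemma hess_sqnorm k (dk : forall a, d a k = 0) :
  \sum_c hessU c c = 0 ->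
  (forall a, \sum_c ric a c * d c u = k * d a u) ->
  (forall a, \sum_c hessU a c * d c u = k * u * d a u) ->
  \sum_a \sum_c hessU a c * hessU c a = 0.
Proof.
move=> tr0 rick hessk.
have hbc b c : h b c = h c b by rewrite -[in LHS]h_sym mxE.
pose y c := \sum_a v a 0 * hessU a c.
(* Self-adjointness of the Hessian turns the eigenvector equation for the covector du into one for
   the gradient [v]. *)
have yE c : y c = k * u * v c 0.
  rewrite /v mxE mulr_sumr.
  under [RHS]eq_bigr => a _ do rewrite [w _ _]mxE mulrCA -hessk hessU_grad mulr_sumr.
  rewrite exchange_big; apply: eq_bigr => b _; rewrite hessUE mulr_sumr.
  by apply: eq_bigr => a _; rewrite (hess_sym a) (hbc c); ring.
have dv a c : d a (v c 0) = hessU a c - \sum_e G a c e * v e 0.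
  by rewrite /hessU mxaddE !mxE addrK.
have divE a : div hessU a = \sum_c d c (hessU a c) +
    (\sum_c \sum_e G c c e * hessU a e - \sum_c \sum_e G a c e * hessU c e).
  rewrite /div; congr (_ + _); rewrite -sumrB; apply: eq_bigr => c _.
  by rewrite -sumrB.
have P1 : \sum_c \sum_a v a 0 * d c (hessU a c) = \sum_a v a 0 * \sum_c d c (hessU a c).
  by rewrite exchange_big; apply: eq_bigr => a _; rewrite mulr_sumr.
have P2 : \sum_c \sum_e G c c e * y e =
    \sum_a v a 0 * \sum_c \sum_e G c c e * hessU a e.
  under [RHS]eq_bigr => a _ do rewrite mulr_sumr.
  rewrite [RHS]exchange_big; apply: eq_bigr => c _ /=.
  under [RHS]eq_bigr => a _ do rewrite mulr_sumr.
  rewrite [RHS]exchange_big; apply: eq_bigr => e _ /=.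
  by rewrite /y mulr_sumr; apply: eq_bigr => a _; ring.
have P3 : \sum_c \sum_a \sum_e G c a e * v e 0 * hessU a c =
    \sum_a v a 0 * \sum_c \sum_e G a c e * hessU c e.
  rewrite exchange_big.
  under [RHS]eq_bigr => a _ do rewrite mulr_sumr.
  rewrite [RHS]exchange_big; apply: eq_bigr => c _ /=.
  under [RHS]eq_bigr => a _ do rewrite mulr_sumr.
  rewrite [RHS]exchange_big; apply: eq_bigr => e _ /=.
  by apply: eq_bigr => a _; rewrite (torsion_free a); ring.
(* Product rule for the divergence of [y], in which the covariant derivative of [v] is again
   [hessU]. *)
have E1 : \sum_c d c (y c) + \sum_c \sum_e G c c e * y e =
    \sum_a v a 0 * div hessU a + \sum_a \sum_c hessU a c * hessU c a.
  transitivity (\sum_c \sum_a hessU c a * hessU a c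
    - \sum_c \sum_a \sum_e G c a e * v e 0 * hessU a c
    + \sum_c \sum_a v a 0 * d c (hessU a c) + \sum_c \sum_e G c c e * y e).
    congr (_ + _); rewrite -sumrB -big_split; apply: eq_bigr => c _ /=.
    rewrite der_sum -sumrB -big_split; apply: eq_bigr => a _ /=.
    by rewrite dM dv mulrBl mulr_suml.
  rewrite P1 P2 P3; under [in RHS]eq_bigr => a _ do rewrite divE mulrDr mulrBr.
  by rewrite big_split sumrB /=; ring.
have trv : \sum_c d c (v c 0) + \sum_c \sum_e G c c e * v e 0 = 0.
  rewrite -[RHS]tr0 -big_split; apply: eq_bigr => c _ /=.
  by rewrite dv subrK.
(* The same divergence computed from [y = k u v]; the divergence of [v] is the trace of [hessU],
   which is 0. *)
have E2 : \sum_c d c (y c) + \sum_c \sum_e G c c e * y e =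
    k * \sum_a v a 0 * d a u.
  transitivity (k * \sum_a v a 0 * d a u + k * u *
     (\sum_c d c (v c 0) + \sum_c \sum_e G c c e * v e 0)).
    rewrite mulrDr addrA; congr (_ + _).
      rewrite !mulr_sumr -big_split; apply: eq_bigr => c _ /=.
      by rewrite yE !dM dk; ring.
    rewrite mulr_sumr; apply: eq_bigr => c _; rewrite mulr_sumr.
    by apply: eq_bigr => e _; rewrite yE; ring.
  by rewrite trv mulr0 addr0.
(* By Bochner's formula the first term of [E1] already equals the whole of [E2], so the squared norm
   must vanish. *)
have E3 : \sum_a v a 0 * div hessU a = k * \sum_a v a 0 * d a u.
  rewrite mulr_sumr; apply: eq_bigr => a _.
  by rewrite div_hessU tr0 der0 add0r rick mulrCA.
by move: E1; rewrite E2 E3 -[X in X = _]addr0 => /addrI <-.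
Qed.
End ConstantScalarCurvature.
End TensorCalculus.

(** * The Levi-Civita connection of a metric *)

Section LeviCivita.
Variables (A : comNzRingType) (n : nat) (d : 'I_n -> A -> A).
Hypothesis dD : forall a x y, d a (x + y) = d a x + d a y.
Hypothesis dM : forall a x y, d a (x * y) = d a x * y + x * d a y.
Variables (g h : 'M[A]_n) (half : A).
Hypotheses (half2 : half *+ 2 = 1) (g_sym : g^T = g) (gh : g *m h = 1%:M).
Local Notation dmx := (dmx d).

Definition levi_civita a : 'M[A]_n := \matrix_(c, b)
  (half * \sum_e h c e * (d a (g b e) + d b (g a e) - d e (g a b))).

Let hg : h *m g = 1%:M. Proof. exact: mulmx1C. Qed.
Let gE b c : g b c = g c b. Proof. by rewrite -[in LHS]g_sym mxE. Qed.

Lemma levi_civita_torsion_free a b c : levi_civita a c b = levi_civita b c a.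
Proof.
rewrite !mxE; congr (_ * _); apply: eq_bigr => e _; rewrite (gE a b).
by congr (_ * (_ - _)); exact: addrC.
Qed.

Lemma inv_metric_sym : h^T = h.
Proof. by rewrite -[LHS]mulmx1 -gh mulmxA -{1}g_sym -trmx_mul gh trmx1 mul1mx. Qed.

(** Lowering the upper index gives the Christoffel symbols of the first kind, from which
    compatibility is read off directly. *)
Lemma lower_levi_civita a f b : (g *m levi_civita a) f b =
  half * (d a (g b f) + d b (g a f) - d f (g a b)).
Proof.
pose X : 'cV[A]_n := \col_e (half * (d a (g b e) + d b (g a e) - d e (g a b))).
have -> : (g *m levi_civita a) f b = (g *m (h *m X)) f 0.
  rewrite [LHS]mxE [RHS]mxE; apply: eq_bigr => c _; rewrite !mxE mulr_sumr.
  by congr (_ * _); apply: eq_bigr => e _; rewrite mxE; ring.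
by rewrite mulmxA gh mul1mx mxE.
Qed.

Lemma levi_civita_compat a : dmx a g = g *m levi_civita a + (g *m levi_civita a)^T.
Proof.
apply/matrixP => b c; rewrite [LHS]mxE mxaddE [_^T _ _]mxE !lower_levi_civita.
rewrite (gE c b) (gE a b) (gE a c) -[LHS]mul1r -half2; ring.
Qed.

(** Differentiate [h *m g = 1] to express the derivative of the inverse by that of [g], then use
    compatibility. *)
Lemma levi_civita_inv a :
  dmx a h = - (levi_civita a *m h) - h *m (levi_civita a)^T.
Proof.
have E : dmx a h = - (h *m dmx a g *m h).
  have : dmx a (h *m g) = 0.
    rewrite hg; apply/matrixP => i j; rewrite !mxE.
    case: eqP => _ /=; [exact: der1|exact: der0].
  rewrite (dmxM dD dM) => /(congr1 (fun X => X *m h)).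
  rewrite mulmxDl mul0mx -mulmxA gh mulmx1 => /eqP.
  by rewrite addr_eq0 => /eqP.
rewrite E levi_civita_compat mulmxDr mulmxDl trmx_mul g_sym.
rewrite !mulmxA hg mul1mx -!mulmxA gh mulmx1 opprD; congr (_ - _).
Qed.
End LeviCivita.

(** * Linear algebra *)

(** Factor [K = C B] through its rank r, with [C] left invertible and [B] right invertible.
    Cancelling in [K K = s K] leaves [B C = s I_r], and the trace of [C B] is that of [B C]. *)
Lemma trace_quasi_idempotent (F : fieldType) n (K : 'M[F]_n) (s : F) :
  K *m K = s *: K -> \tr K = s * (\rank K)%:R.
Proof.
have := mulmx_base K; have /row_fullP := col_base_full K.
have /row_freeP := row_base_free K; move: (col_base K) (row_base K).
move: (\rank K) => r C B [B' BB'] [C' C'C] <- KK.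
have BC : B *m C = s%:M.
  move/(congr1 (fun X => C' *m X *m B')): KK.
  rewrite !mulmxA C'C mul1mx -!mulmxA BB' mulmx1 => ->.
  by rewrite -scalemxAl -scalemxAr -mulmxA BB' mulmx1 C'C scalemx1.
by rewrite mxtrace_mulC BC mxtrace_scalar mulr_natr.
Qed.

(** * Positive definite matrices *)

Section PositiveDefinite.
Variable R : realType.

Definition posdef n (h : 'M[R]_n) :=
  h^T = h /\ forall v : 'rV_n, v != 0 -> 0 < (v *m h *m v^T) 0 0.

Lemma posdef_unit n (h : 'M[R]_n) : posdef h -> h \in unitmx.
Proof.
move=> [hT hp]; rewrite unitmxE unitfE; apply/negP => /det0P[v v0 vh].
by have := hp v v0; rewrite vh mul0mx mxE ltxx.
Qed.

Lemma posdef_inv n (g : 'M[R]_n) : posdef g -> posdef (invmx g).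
Proof.
move=> pg; have ug := posdef_unit pg; have [gT gp] := pg.
split=> [|v v0]; first by rewrite trmx_inv gT.
have : 0 < ((v *m invmx g) *m g *m (v *m invmx g)^T) 0 0.
  apply: gp; apply: contraNneq v0 => vg.
  by rewrite -(mulmx1 v) -(mulVmx ug) mulmxA vg mul0mx.
by rewrite mulmxKV // trmx_mul trmx_inv gT mulmxA.
Qed.

(** Induction on the size: split off the first row and column and apply the induction hypothesis to
    the Schur complement [S]. *)
Lemma cholesky n (h : 'M[R]_n) : posdef h -> exists L : 'M[R]_n, h = L *m L^T.
Proof.
elim: n h => [|n IH] h [hT hp].
  by exists 0; apply/matrixP => -[].
move: h hT hp; rewrite -[n.+1]/(1 + n)%N => h hT hp.
pose a := h 0 0; pose b := ursubmx h; pose C := drsubmx h.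
have hE : h = block_mx a%:M b b^T C.
  rewrite -[LHS]submxK; congr block_mx; last by rewrite /b trmx_ursub hT.
  by apply/matrixP => i j; rewrite !ord1 !mxE; congr (h _ _); apply: val_inj.
have a0 : 0 < a.
  have := hp (row_mx 1%:M 0); rewrite {1}hE mul_row_block tr_row_mx mul_row_col.
  rewrite !mul1mx !mul0mx !addr0 trmx0 mulmx0 addr0 trmx1 mulmx1 mxE eqxx mulr1n.
  apply; apply/eqP => /matrixP/(_ 0 (lshift _ 0)); rewrite row_mxEl !mxE eqxx => /eqP.
  by rewrite oner_eq0.
pose S := C - a^-1 *: (b^T *m b).
have CT : C^T = C by rewrite /C trmx_drsub hT.
have [|L' SL] := IH S.
  split=> [|v v0].
    by rewrite /S linearB linearZ /= trmx_mul trmxK CT.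
  (* The first entry is chosen to annihilate the first block, so the form of [h] at this vector is
     the form of [S] at [v]. *)
  have := hp (row_mx (- a^-1 *: (v *m b^T)) v).
  rewrite {1}hE mul_row_block tr_row_mx mul_row_col.
  have -> : - a^-1 *: (v *m b^T) *m a%:M + v *m b^T = 0.
    rewrite -scalemxAl mul_mx_scalar scalerA mulNr mulVf ?gt_eqF // scaleN1r.
    by rewrite addNr.
  rewrite mul0mx add0r => H.
  have -> : v *m S = - a^-1 *: (v *m b^T) *m b + v *m C.
    by rewrite /S mulmxBr addrC -scalemxAr -scalemxAl scaleNr mulmxA.
  apply: H; apply: contraNneq v0 => /matrixP H; apply/eqP/matrixP => i j.
  by have := H i (rshift 1 j); rewrite row_mxEr !mxE.
pose r := Num.sqrt a.
have r0 : r != 0 by rewrite gt_eqF // sqrtr_gt0.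
have rr : r * r = a by rewrite -expr2 sqr_sqrtr // ltW.
exists (block_mx r%:M 0 (r^-1 *: b^T) L').
rewrite tr_block_mx mulmx_block !trmx0 !mul0mx !mulmx0 !addr0.
rewrite linearZ /= trmxK tr_scalar_mx -SL hE; congr block_mx.
- by rewrite -scalar_mxM rr.
- by rewrite -scalemxAr mul_scalar_mx scalerA mulVf // scale1r.
- by rewrite mul_mx_scalar scalerA mulfV // scale1r.
- by rewrite -scalemxAl -scalemxAr scalerA -invfM rr /S addrC subrK.
Qed.

(** The product [H h] need not be symmetric, but with [h = L L^T] the trace of its square is that of
    the square of the symmetric matrix [L^T H L], a sum of squares. *)
Lemma selfadjoint_trace_sqr_eq0 n (h H : 'M[R]_n) : posdef h -> H^T = H ->
  \tr (H *m h *m (H *m h)) = 0 -> H = 0.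
Proof.
move=> ph HT; have uh := posdef_unit ph; have [L hL] := cholesky ph.
pose M := L^T *m H *m L.
have MT : M^T = M by rewrite /M !trmx_mul trmxK HT mulmxA.
have -> : \tr (H *m h *m (H *m h)) = \sum_i \sum_j M i j ^+ 2.
  rewrite hL !mulmxA mxtrace_mulC !mulmxA.
  have -> : L^T *m H *m L *m L^T *m H *m L = M *m M by rewrite /M !mulmxA.
  apply: eq_bigr => i _; rewrite mxE; apply: eq_bigr => j _.
  by rewrite expr2 -[in X in _ = _ * X]MT [M^T _ _]mxE.
move=> /eqP; rewrite psumr_eq0 => [/allP M0|i _]; last first.
  by apply: sumr_ge0 => j _; exact: sqr_ge0.
have {M0} M0 : M = 0.
  apply/matrixP => i j; have /M0 : i \in index_enum 'I_n by rewrite mem_index_enum.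
  rewrite /= psumr_eq0 => [/allP/(_ j)|k _]; last exact: sqr_ge0.
  by rewrite mem_index_enum /= sqrf_eq0 [RHS]mxE => /(_ isT)/eqP.
have : h *m H *m h = 0.
  rewrite hL; have -> : L *m L^T *m H *m (L *m L^T) = L *m M *m L^T by rewrite /M !mulmxA.
  by rewrite M0 mulmx0 mul0mx.
move=> /(congr1 (fun X => invmx h *m X *m invmx h)).
by rewrite mulmxA (mulmxA (invmx h)) mulVmx // mul1mx mulmxK // mulmx0 mul0mx.
Qed.
End PositiveDefinite.

(** * Smooth functions on an open set *)

Section SmoothIn.
Variables (R : realType) (n : nat).
Local Notation V := 'rV[R]_n.
Local Notation e_ := (@basis_vector R n).
Implicit Types (f g : V -> R) (W : set V).

(** Grading smoothness by the order [k] makes closure under sums, products and inverses an induction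
    on [k]. *)
Fixpoint diff_upto W (k : nat) f : Prop :=
  (forall x, W x -> differentiable f x) /\
  if k is k'.+1 then forall a, diff_upto W k' ('D_(e_ a) f) else True.

Definition smooth_in W f := forall k, diff_upto W k f.

Lemma diff_uptoW W k f : diff_upto W k.+1 f -> diff_upto W k f.
Proof.
elim: k f => [|k IH] f [df Df]; first by split.
by split=> // a; apply: IH.
Qed.

Lemma near_eq_differentiable f g x :
  (\near x, f x = g x) -> differentiable f x -> differentiable g x.
Proof.
move=> fg /diff_locallyP[dfc dfE].
have dgE : g \o shift x = cst (g x) + 'd f x +o_ 0 id.
  apply/eqaddoP => e e0; move/eqaddoP: dfE => /(_ e e0) dfE.
  have fg0 : \forall y \near 0, f (y + x) = g (y + x).
    by move: fg; rewrite (near_shift 0) subr0; apply: filterS => y; rewrite /= ?subr0 ?sub0r ?opprK.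
  rewrite -(nbhs_singleton fg).
  by apply: filterS2 fg0 dfE => y fgy; rewrite /= !fctE /= -fgy.
apply/diff_locallyP; have dgf := diff_unique dfc dgE.
by rewrite dgf.
Qed.

Lemma eq_diff_upto W k f g : open W -> (forall x, W x -> f x = g x) ->
  diff_upto W k f -> diff_upto W k g.
Proof.
move=> oW; elim: k f g => [|k IH] f g fg [df Df].
  split=> // x Wx; apply: near_eq_differentiable (df x Wx).
  by near=> y; apply: fg; near: y; exact: open_nbhs_nbhs.
split=> [x Wx|a].
  apply: near_eq_differentiable (df x Wx).
  by near=> y; apply: fg; near: y; exact: open_nbhs_nbhs.
apply: IH (Df a) => x Wx; apply: near_eq_derive.
by near=> y; apply: fg; near: y; exact: open_nbhs_nbhs.
Unshelve. all: by end_near. Qed.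

Lemma diff_upto_local W k f :
  (forall x, W x -> exists2 W', W' x & diff_upto W' k f) -> diff_upto W k f.
Proof.
elim: k f => [|k IH] f H; split=> //.
- by move=> x /H[W' W'x []] /(_ x W'x).
- by move=> x /H[W' W'x []] /(_ x W'x).
- by move=> a; apply: IH => x /H[W' W'x []] _ /(_ a); exists W'.
Qed.

Lemma diff_uptoS W W' k f : W' `<=` W -> diff_upto W k f -> diff_upto W' k f.
Proof. by move=> WW fk; apply: diff_upto_local => x /WW Wx; exists W. Qed.

Lemma smooth_in_iterated W f :
  (forall s x, W x -> differentiable (iterated_partial s f) x) -> smooth_in W f.
Proof.
move=> H k; elim: k f H => [|k IH] f H; split=> //; try exact: (H [::]).
(* The recursion of [diff_upto] takes the innermost derivative first, which is the last entry of the
   list. *)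
move=> a; apply: IH => s x Wx; have := H (rcons s a) x Wx.
by rewrite /iterated_partial foldr_rcons.
Qed.

Lemma smooth_on_in D W f : smooth_on D f -> open W -> W `<=` D -> smooth_in W f.
Proof.
move=> sf oW WD k; apply: diff_upto_local => x Wx.
have [W' [F [oW' W'x dF Ff]]] := sf x (WD x Wx).
exists (W' `&` W); first by split.
apply: (@eq_diff_upto _ _ F); first exact: openI.
  by move=> y [W'y /WD Dy]; apply: Ff.
by apply: (@diff_uptoS W'); [move=> y []|apply: smooth_in_iterated].
Qed.

Lemma diff_upto_cst W k (c : R) : diff_upto W k (cst c).
Proof.
elim: k c => [|k IH] c; split=> //; try by move=> *; exact: differentiable_cst.
move=> a; rewrite (_ : 'D_(e_ a) (cst c) = cst 0) //.
by apply/funext => x; rewrite derive_cst.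
Qed.

Section Open.
Variable W : set V.
Hypothesis oW : open W.

Lemma diff_uptoD k f g : diff_upto W k f -> diff_upto W k g -> diff_upto W k (f + g).
Proof.
elim: k f g => [|k IH] f g [df Df] [dg Dg].
  by split=> // x Wx; apply: differentiableD; [exact: df|exact: dg].
split=> [x Wx|a]; first by apply: differentiableD; [exact: df|exact: dg].
apply: (eq_diff_upto oW) (IH _ _ (Df a) (Dg a)) => x Wx.
by rewrite deriveD //; apply: diff_derivable; [exact: df|exact: dg].
Qed.

Lemma diff_uptoM k f g : diff_upto W k f -> diff_upto W k g -> diff_upto W k (f * g).
Proof.
elim: k f g => [|k IH] f g fk gk; have [df Df] := fk; have [dg Dg] := gk.
  by split=> // x Wx; apply: differentiableM; [exact: df|exact: dg].
split=> [x Wx|a]; first by apply: differentiableM; [exact: df|exact: dg].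
apply: (eq_diff_upto oW) (diff_uptoD (IH _ _ (diff_uptoW fk) (Dg a))
  (IH _ _ (diff_uptoW gk) (Df a))) => x Wx.
by rewrite deriveM //; apply: diff_derivable; [exact: df|exact: dg].
Qed.

Lemma diff_uptoV k f : (forall x, W x -> f x != 0) ->
  diff_upto W k f -> diff_upto W k (fun x => (f x)^-1).
Proof.
move=> f0; elim: k => [|k IH] fk; have [df Df] := fk.
  by split=> // x Wx; apply: differentiableV; [exact: df|exact: f0].
split=> [x Wx|a]; first by apply: differentiableV; [exact: df|exact: f0].
have IV := IH (diff_uptoW fk).
apply: (eq_diff_upto oW) (diff_uptoM (diff_upto_cst W k (-1))
  (diff_uptoM (diff_uptoM IV IV) (Df a))) => x Wx.
rewrite deriveV; [|exact: f0|by apply: diff_derivable; exact: df].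
by rewrite /GRing.mul /= /GRing.scale /= mulN1r expr2 invfM mulNr.
Qed.

Lemma smooth_in_cst (c : R) : smooth_in W (cst c).
Proof. by move=> k; apply: diff_upto_cst. Qed.

Lemma smooth_inD f g : smooth_in W f -> smooth_in W g -> smooth_in W (f + g).
Proof. by move=> fs gs k; apply: diff_uptoD. Qed.

Lemma smooth_inM f g : smooth_in W f -> smooth_in W g -> smooth_in W (f * g).
Proof. by move=> fs gs k; apply: diff_uptoM. Qed.

Lemma smooth_in_derive a f : smooth_in W f -> smooth_in W ('D_(e_ a) f).
Proof. by move=> fs k; have [_ H] := fs k.+1; apply: H. Qed.

Lemma smooth_in_differentiable f x : smooth_in W f -> W x -> differentiable f x.
Proof. by move=> fs; have [H _] := fs 0%N; apply: H. Qed.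

End Open.

Lemma is_derive_line f (x v : V) (t : R) : differentiable f (x + t *: v) ->
  is_derive t (1 : R) (fun s : R => f (x + s *: v)) ('D_v f (x + t *: v)).
Proof.
move=> df.
have dl : differentiable (fun s : R => x + s *: v) t by [].
have dc : differentiable (f \o (fun s : R => x + s *: v)) t.
  exact: differentiable_comp.
apply: DeriveDef; first exact: diff_derivable.
rewrite (deriveE _ dc) diff_comp //= deriveE //; congr ('d f _ _).
rewrite -deriveE // deriveD //; last exact: diff_derivable.
by rewrite derive_cst add0r deriveE // diff_val /= scale1r.
Qed.

(* Mean value theorem applied twice to the second difference of [f]. *)
Lemma second_difference f (x p q : V) (t : R) : 0 < t ->
  (forall r s : R, 0 <= r <= t -> 0 <= s <= t -> differentiable f (x + r *: p + s *: q)) ->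
  (forall r s : R, 0 <= r <= t -> 0 <= s <= t ->
    differentiable ('D_p f) (x + r *: p + s *: q)) ->
  exists r s : R, [/\ 0 <= r <= t, 0 <= s <= t &
    f (x + t *: p + t *: q) - f (x + t *: p) - f (x + t *: q) + f x =
    t ^+ 2 * 'D_q ('D_p f) (x + r *: p + s *: q)].
Proof.
move=> t0 df ddf.
have tt : 0 <= t <= t by rewrite lexx (ltW t0).
have t00 : 0 <= (0 : R) <= t by apply/andP; split; [exact: lexx|exact: ltW].
have swap r s : x + s *: q + r *: p = x + r *: p + s *: q by rewrite addrAC.
have x0 r : x + r *: p = x + r *: p + 0 *: q by rewrite scale0r addr0.
pose phi r := f (x + t *: q + r *: p) - f (x + r *: p).
pose dphi r := 'D_p f (x + t *: q + r *: p) - 'D_p f (x + r *: p).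
have dp (r : R) : 0 <= r <= t -> is_derive r 1 phi (dphi r).
  move=> rt; apply: is_deriveB; apply: is_derive_line.
    by rewrite swap; apply: df.
  by rewrite x0; apply: df.
have [||r rt E] := @MVT _ phi dphi 0 t t0.
- by move=> r /[!in_itv]/= /andP[/ltW r0 /ltW rt]; apply: dp; rewrite r0.
- apply: derivable_within_continuous => r; rewrite in_itv /= => /dp.
  by move=> ?; exact: ex_derive.
have {rt} rt : 0 <= r <= t by move: rt; rewrite in_itv /= => /andP[/ltW -> /ltW].
pose psi s := 'D_p f (x + r *: p + s *: q).
have dps (s : R) : 0 <= s <= t -> is_derive s 1 psi ('D_q ('D_p f) (x + r *: p + s *: q)).
  by move=> st; apply: is_derive_line; apply: ddf.
have [||s st E'] := @MVT _ psi (fun s => 'D_q ('D_p f) (x + r *: p + s *: q)) 0 t t0.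
- by move=> s /[!in_itv]/= /andP[/ltW s0 /ltW st]; apply: dps; rewrite s0.
- apply: derivable_within_continuous => s; rewrite in_itv /= => /dps.
  by move=> ?; exact: ex_derive.
have {st} st : 0 <= s <= t by move: st; rewrite in_itv /= => /andP[/ltW -> /ltW].
exists r, s; split=> //; move: E; rewrite /phi /dphi !scale0r !addr0 !subr0.
rewrite swap => E.
have -> : f (x + t *: p + t *: q) - f (x + t *: p) - f (x + t *: q) + f x
    = f (x + t *: p + t *: q) - f (x + t *: p) - (f (x + t *: q) - f x).
  by ring.
rewrite E; move: E'; rewrite /psi scale0r addr0 subr0 swap => ->.
by rewrite expr2 mulrC mulrAC mulrA.
Qed.

Lemma near_parallelogram (P : set V) (x p q : V) : nbhs x P ->
  exists2 t : R, 0 < t &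
    forall r s : R, 0 <= r <= t -> 0 <= s <= t -> P (x + r *: p + s *: q).
Proof.
move=> /nbhs_ballP[e /= e0 eP].
(* The summand 1 keeps the denominator positive when both vectors are zero. *)
have N0 : 0 < `|p| + `|q| + 1 by rewrite ltr_wpDl ?addr_ge0.
exists (e / (`|p| + `|q| + 1)); first by rewrite divr_gt0.
move=> r s /andP[r0 rt] /andP[s0 st]; apply: eP.
rewrite -ball_normE /= -addrA opprD addNKr normrN.
apply: (le_lt_trans (ler_normD _ _)); rewrite !normrZ !ger0_norm //.
apply: (@le_lt_trans _ _ (e / (`|p| + `|q| + 1) * (`|p| + `|q|))).
  by rewrite mulrDr lerD // ler_wpM2r.
by rewrite -mulrA gtr_pMr // ltr_pdivrMl // mulr1 ltrDl.
Qed.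

(** Both mixed derivatives, taken at points near [x], equal the same second difference divided by
    t^2. If they differed at [x], continuity with tolerance half the gap would be contradicted. *)
Lemma schwarz W f a b x : open W -> smooth_in W f -> W x ->
  'D_(e_ a) ('D_(e_ b) f) x = 'D_(e_ b) ('D_(e_ a) f) x.
Proof.
move=> oW fs Wx; apply/eqP; apply: contraT => AB.
set A := 'D_(e_ a) ('D_(e_ b) f); set B := 'D_(e_ b) ('D_(e_ a) f).
have dD g : smooth_in W g -> forall y, W y -> differentiable g y.
  by move=> gs y Wy; apply: smooth_in_differentiable gs Wy.
have fa := smooth_in_derive a fs; have fb := smooth_in_derive b fs.
have cA : {for x, continuous A}.
  by apply: differentiable_continuous; apply: dD Wx; apply: smooth_in_derive.
have cB : {for x, continuous B}.
  by apply: differentiable_continuous; apply: dD Wx; apply: smooth_in_derive.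
have e0 : 0 < `|A x - B x| / 2 by rewrite divr_gt0 // normr_gt0 subr_eq0.
have /cvgrPdist_lt/(_ _ e0) nA := cA.
have /cvgrPdist_lt/(_ _ e0) nB := cB.
have nW : nbhs x W by exact: open_nbhs_nbhs.
have [t t0 H] := near_parallelogram (e_ a) (e_ b) (filterI nW (filterI nA nB)).
have swap r s : x + s *: e_ b + r *: e_ a = x + r *: e_ a + s *: e_ b.
  by rewrite addrAC.
have [||r [s [r0 s0 E1]]] := @second_difference f x (e_ b) (e_ a) t t0.
- by move=> r s r0 s0; rewrite swap; apply: dD => //; have [] := H s r s0 r0.
- by move=> r s r0 s0; rewrite swap; apply: dD => //; have [] := H s r s0 r0.
have [||r' [s' [r0' s0' E2]]] := @second_difference f x (e_ a) (e_ b) t t0.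
- by move=> r1 s1 r1t s1t; apply: dD => //; have [] := H r1 s1 r1t s1t.
- by move=> r1 s1 r1t s1t; apply: dD => //; have [] := H r1 s1 r1t s1t.
have [_ [hA _]] := H s r s0 r0; have [_ [_ hB]] := H r' s' r0' s0'.
have t2 : t ^+ 2 != 0 by rewrite expf_neq0 // gt_eqF.
have EAB : A (x + s *: e_ a + r *: e_ b) = B (x + r' *: e_ a + s' *: e_ b).
  apply: (mulfI t2); rewrite -swap; apply: etrans (esym E1) (etrans _ E2).
  by rewrite (swap t t); congr (_ + _); rewrite addrAC.
have : `|A x - B x| < `|A x - B x|.
  rewrite [ltRHS]splitr.
  apply: le_lt_trans (ltrD hA hB); rewrite EAB [X in _ <= _ + X]distrC.
  by apply: le_trans (ler_normD _ _); rewrite subrKA.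
by rewrite ltxx.
Qed.
End SmoothIn.

(** * The ring of smooth functions on an open set and its derivations *)

Section SmoothFunctions.
Variables (R : realType) (n : nat) (W : set 'rV[R]_n) (oW : open W).
Local Notation V := 'rV[R]_n.

(** The openness proof is a parameter, so that the subring instance on the subtype can use it. *)
Definition smooth_pred of open W : pred (V -> R) := fun f => `[< smooth_in W f >].

Record smooth_fun :=
  SmoothFun { smooth_val :> V -> R; _ : smooth_pred oW smooth_val }.

HB.instance Definition _ := [isSub for smooth_val].
HB.instance Definition _ := [Choice of smooth_fun by <:].

Fact smooth_subring : subring_closed (smooth_pred oW).
Proof.
split=> [|f g|f g]; rewrite /in_mem /= /smooth_pred.
- by apply/asboolP; exact: smooth_in_cst.
- move=> /asboolP fs /asboolP gs; apply/asboolP; apply: smooth_inD => //.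
  rewrite (_ : - g = cst (-1) * g); last by rewrite -[LHS]mulN1r.
  by apply: smooth_inM => //; apply: smooth_in_cst.
- by move=> /asboolP fs /asboolP gs; apply/asboolP; apply: smooth_inM.
Qed.
HB.instance Definition _ :=
  GRing.SubChoice_isSubComNzRing.Build _ _ smooth_fun smooth_subring.

Lemma smoothP (f : smooth_fun) : smooth_in W f.
Proof. by case: f => f /= /asboolP. Qed.

Definition to_smooth (f : V -> R) (fs : smooth_in W f) : smooth_fun :=
  SmoothFun (introT (asboolP _) fs).

(* Values off [W] are irrelevant; derivatives are set to [0] there so that the
   Leibniz and Schwarz rules hold as identities of functions on the whole space. *)
Definition der_fun a (f : V -> R) (x : V) : R :=
  if `[< W x >] then 'D_(basis_vector R a) f x else 0.

Fact der_fun_smooth a (f : smooth_fun) : smooth_in W (der_fun a f).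
Proof.
move=> k; apply: (eq_diff_upto oW) (smooth_in_derive a (smoothP f) k) => x Wx.
by rewrite /der_fun asboolT.
Qed.

Definition der a (f : smooth_fun) : smooth_fun := to_smooth (der_fun_smooth a f).

Lemma derE a (f : smooth_fun) x : W x -> der a f x = 'D_(basis_vector R a) f x.
Proof. by move=> Wx; rewrite /= /der_fun asboolT. Qed.

Lemma smooth_derivable (f : smooth_fun) x v : W x -> derivable f x v.
Proof.
by move=> Wx; apply/diff_derivable/(smooth_in_differentiable (smoothP f)).
Qed.

Lemma derD a f g : der a (f + g) = der a f + der a g.
Proof.
apply: val_inj; apply/funext => x /=; rewrite /der_fun !fctE.
case: asboolP => Wx; last by rewrite addr0.
by rewrite deriveD //; apply: smooth_derivable.
Qed.

Lemma derM a f g : der a (f * g) = der a f * g + f * der a g.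
Proof.
apply: val_inj; apply/funext => x /=; rewrite /der_fun !fctE.
case: asboolP => Wx; last by rewrite mul0r mulr0 addr0.
rewrite deriveM; try exact: smooth_derivable.
by rewrite addrC; congr (_ + _); exact: mulrC.
Qed.

Lemma derC a b f : der a (der b f) = der b (der a f).
Proof.
apply: val_inj; apply/funext => x /=; rewrite /der_fun.
case: asboolP => Wx; last by [].
have near_der c e : 'D_(basis_vector R c) (der_fun e f) x =
    'D_(basis_vector R c) ('D_(basis_vector R e) f) x.
  apply: near_eq_derive; near=> y; rewrite /der_fun asboolT //.
  by near: y; exact: open_nbhs_nbhs.
by rewrite !near_der; apply: schwarz oW (smoothP f) Wx.
Unshelve. all: by end_near. Qed.

Definition eval (x : V) (f : smooth_fun) : R := f x.

Fact eval_zmod x : zmod_morphism (eval x).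
Proof. by []. Qed.
Fact eval_monoid x : monoid_morphism (eval x).
Proof. by []. Qed.
HB.instance Definition _ x :=
  GRing.isZmodMorphism.Build smooth_fun R (eval x) (eval_zmod x).
HB.instance Definition _ x :=
  GRing.isMonoidMorphism.Build smooth_fun R (eval x) (eval_monoid x).

Lemma evalM x f g : eval x (f * g) = eval x f * eval x g.
Proof. by []. Qed.
Lemma evalD x f g : eval x (f + g) = eval x f + eval x g.
Proof. by []. Qed.
Lemma evalN x f : eval x (- f) = - eval x f.
Proof. by []. Qed.
Lemma eval_sum x (I : Type) (r : seq I) (P : pred I) (F : I -> smooth_fun) :
  eval x (\sum_(i <- r | P i) F i) = \sum_(i <- r | P i) eval x (F i).
Proof. exact: (raddf_sum (eval x)). Qed.
Lemma eval_nat x k : eval x k%:R = k%:R.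
Proof. exact: (rmorph_nat (eval x)). Qed.

Lemma cst_smooth (c : R) : smooth_in W (cst c : V -> R).
Proof. exact: smooth_in_cst. Qed.
Definition csts (c : R) : smooth_fun := to_smooth (cst_smooth c).

Lemma eval_cst x c : eval x (csts c) = c.
Proof. by []. Qed.

Lemma eval1 x : eval x 1 = 1.
Proof. by []. Qed.

Definition evalE := (evalM, evalD, evalN, eval_cst, eval1, eval_nat).

Lemma der_cst a c : der a (csts c) = 0.
Proof.
apply: val_inj; apply/funext => x /=; rewrite /der_fun.
by case: asboolP => // _; exact: derive_cst.
Qed.
End SmoothFunctions.

(** * Quasi-Einstein equation on an open set of R^n *)

(** Around an interior point all small increments stay in [D], so the restricted limit is the
    ordinary one. *)
Lemma partialE (R : realType) n (D W : set 'rV[R]_n) a f x :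
  open W -> W `<=` D -> W x -> partial D a f x = 'D_(basis_vector R a) f x.
Proof.
move=> oW WD Wx; rewrite /partial /derive.
have -> : within [set h : R | D (x + h *: basis_vector R a)] (0 : R)^' = (0 : R)^'.
  apply/funext => P; apply/propext; rewrite /within /=.
  have nD : \forall h \near (0 : R)^', D (x + h *: basis_vector R a).
    apply: cvg_within.
    have : (fun h : R => x + h *: basis_vector R a) @ 0 --> x + 0 *: basis_vector R a.
      apply: cvgD; first exact: cvg_cst.
      by apply: cvgZr_tmp; exact: cvg_id.
    rewrite scale0r addr0; apply; apply: filterS WD _.
    exact: open_nbhs_nbhs.
  split=> H; last by apply: filterS H => h Ph _.
  by apply: filterS2 nD H => h Dh; apply.
rewrite (_ : (fun h => _) = fun h : R => h^-1 *:
  ((f \o shift x) (h *: basis_vector R a) - f x)) //.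
by apply/funext => h; rewrite /= [h *: _ + x]addrC.
Qed.

Section Local.
Variables (R : realType) (n : nat) (W : set 'rV[R]_n) (oW : open W).
Local Notation V := 'rV[R]_n.
Local Notation S := (smooth_fun oW).

Lemma der_off a (f : S) x : ~ W x -> der a f x = 0.
Proof. by move=> Wx; rewrite /= /der_fun asboolF. Qed.

Lemma smooth_ext (f g : S) :
  (forall x, W x -> f x = g x) -> (forall x, ~ W x -> f x = g x) -> f = g.
Proof.
move=> H1 H2; apply/val_inj/funext => x.
by case: (pselect (W x)) => [/H1|/H2].
Qed.

(** Equality in the ring of smooth functions is equality on the whole space, so values off [W] are
    set to a constant that makes the required identities hold there too. *)
Lemma extend_smooth (f : V -> R) (c : R) : smooth_in W f ->
  smooth_in W (fun x => if `[< W x >] then f x else c).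
Proof.
by move=> fs k; apply: (eq_diff_upto oW) (fs k) => x Wx; rewrite asboolT.
Qed.

Definition extend (f : V -> R) (c : R) (fs : smooth_in W f) : S :=
  to_smooth oW (extend_smooth c fs).

Lemma extendE f c fs x : W x -> @extend f c fs x = f x.
Proof. by move=> Wx /=; rewrite asboolT. Qed.

Lemma extend_off f c fs x : ~ W x -> @extend f c fs x = c.
Proof. by move=> Wx /=; rewrite asboolF. Qed.

(** Cofactor formula. Invertibility is required at every point of the space because [gA *m hA = 1]
    is an identity of functions on all of it. *)
Lemma smooth_mx_inv (gA : 'M[S]_n) :
  (forall x, map_mx (eval x) gA \in unitmx) -> exists hA : 'M[S]_n, gA *m hA = 1%:M.
Proof.
move=> gu; pose D : S := \det gA.
have D0 x : D x != 0.
  by have := gu x; rewrite unitmxE unitfE det_map_mx.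
have Dinv : smooth_in W (fun x => (D x)^-1).
  by move=> k; apply: diff_uptoV => //; exact: smoothP.
exists (to_smooth oW Dinv *: \adj gA).
rewrite -scalemxAr mul_mx_adj scale_scalar_mx.
rewrite (_ : _ * _ = 1) //; apply/val_inj/funext => x.
by rewrite /= -/D mulrC; apply: mulfV.
Qed.
End Local.

(** * Pointwise consequences of the quasi-Einstein equation *)

Section LocalQuasiEinstein.
Variables (R : realType) (n : nat) (W : set 'rV[R]_n) (oW : open W).
Local Notation V := 'rV[R]_n.
Local Notation A := (smooth_fun oW).
Local Notation d := (@der R n W oW).
Local Notation cs := (csts oW).
Variables (g h : 'M[A]_n).
Hypotheses (g_sym : g^T = g) (gh : g *m h = 1%:M).

Definition gamma := levi_civita d g h (cs 2^-1).
Definition ricci_mx : 'M[A]_n := \matrix_(a, b) \sum_c curv d gamma c a c b.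

Variables (u : A) (m lam s : R).
Hypothesis m_gt1 : 1 < m.
Hypothesis u_off : forall x, ~ W x -> u x = 0.
Hypothesis h_pos : forall x, W x -> posdef (map_mx (eval x) h).
Hypothesis qe : forall x a b, W x ->
  m * eval x (hess d gamma u a b) =
  u x * (eval x (ricci_mx a b) - lam * eval x (g a b)).
Hypothesis scal : forall x, W x ->
  \sum_a \sum_b eval x (h a b) * eval x (ricci_mx a b) = s.

Let dD := @derD R n W oW.
Let dM := @derM R n W oW.
Let dC := @derC R n W oW.

Lemma half2 : cs 2^-1 *+ 2 = 1.
Proof.
apply/val_inj/funext => x; rewrite /= [LHS](_ : _ = 2^-1 + 2^-1 :> R) //.
by rewrite [RHS](_ : _ = 1 :> R) //; lra.
Qed.

Let tf := levi_civita_torsion_free d h (cs 2^-1) g_sym.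
Let hs := inv_metric_sym g_sym gh.
Let dh := levi_civita_inv dD dM half2 g_sym gh.

Let K := hessU d gamma h u.
Let q := ric d gamma h.
Let sA := \sum_c q c c.

Lemma eval_scal x : W x -> eval x sA = s.
Proof.
move=> Wx; rewrite -[RHS](scal Wx) eval_sum; apply: eq_bigr => a _.
transitivity (eval x (\sum_b h a b * ricci_mx a b)); last first.
  by rewrite eval_sum; apply: eq_bigr => b _; rewrite evalM.
congr (eval x _); rewrite /q /ric /curvU.
under eq_bigr => b _ do rewrite mxE.
rewrite exchange_big; apply: eq_bigr => b _.
by rewrite mxE -[in RHS]hs [h^T _ _]mxE mulrC mulr_suml.
Qed.

(** [sA] is known to equal [s] only on [W], where it is therefore locally constant; off [W] the
    derivation is 0 by convention. *)
Lemma der_scal a : d a sA = 0.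
Proof.
apply: smooth_ext => x Wx; last exact: der_off.
rewrite derE // [RHS](_ : _ = 0 :> R) // -(derive_cst s x (basis_vector R a)).
apply: near_eq_derive; near=> y; apply: eval_scal.
by near: y; exact: open_nbhs_nbhs.
Unshelve. all: by end_near. Qed.

Lemma qe_smooth a c : cs m * K a c = u * (q a c - cs lam * (a == c)%:R).
Proof.
have E b : cs m * hess d gamma u a b = u * (ricci_mx a b - cs lam * g a b).
  apply: smooth_ext => x Wx; first exact: qe.
  (* Off [W] both [u] and all derivatives are 0, hence both sides vanish. *)
  have du e f : eval x (d e f) = 0 by exact: der_off.
  rewrite -[LHS]/(eval x _) -[RHS]/(eval x _) !evalM [eval x u]u_off // mul0r.
  rewrite /hess evalD evalN du sub0r eval_sum big1 ?oppr0 ?mulr0 //.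
  by move=> e _; rewrite evalM du mulr0.
rewrite /K (hessUE dD dM hs dh) mulr_sumr.
under eq_bigr => b _ do rewrite mulrA E -mulrA mulrBl.
rewrite -mulr_sumr; congr (_ * _); rewrite sumrB; congr (_ - _).
  rewrite /q /ric /curvU; under [RHS]eq_bigr => b _ do rewrite mxE.
  rewrite exchange_big; apply: eq_bigr => b _.
  by rewrite mxE mulr_suml.
transitivity (cs lam * (g *m h) a c); last by rewrite gh mxE.
by rewrite mxE mulr_sumr; apply: eq_bigr => b _; rewrite mulrA.
Qed.

Lemma smooth_hess_grad a : cs m * (cs m - 1) * (\sum_c K a c * d c u) =
  - (sA + (cs m - n%:R) * cs lam) * (u * d a u).
Proof.
by apply: (qe_hess_grad dD dM dC tf half2 hs dh _ _ der_scal qe_smooth erefl) => b;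
  exact: der_cst.
Qed.

Lemma smooth_ric_grad a : (cs m - 1) * (\sum_c q a c * d c u) =
  ((n%:R - 1) * cs lam - sA) * d a u.
Proof.
by apply: (qe_ric_grad dD dM dC tf half2 hs dh _ _ der_scal qe_smooth erefl) => b;
  exact: der_cst.
Qed.

Lemma smooth_laplacian : cs m * \sum_c K c c = u * (sA - n%:R * cs lam).
Proof. exact: qe_laplacian qe_smooth erefl. Qed.

Let Kx x := map_mx (eval x) (\matrix_(a, c) K a c).
Let Hx x := map_mx (eval x) (\matrix_(a, b) hess d gamma u a b).

Lemma KxE x : Kx x = Hx x *m map_mx (eval x) h.
Proof.
rewrite /Kx /Hx -map_mxM; congr (map_mx _ _); apply/matrixP => a c.
rewrite !mxE /K (hessUE dD dM hs dh).
by apply: eq_bigr => b _; rewrite mxE.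
Qed.

Lemma Hx_sym x : (Hx x)^T = Hx x.
Proof. by apply/matrixP => a b; rewrite !mxE (hess_sym dC tf). Qed.

(** [r] is the rank of the Hessian at [x]. The derivative of [smooth_hess_grad] at a critical point
    makes [K] a multiple of an idempotent or square-zero, so its trace is determined by its rank;
    comparison with [smooth_laplacian] gives the relation. *)
Lemma critical_point x : W x -> u x != 0 -> (forall a, eval x (d a u) = 0) ->
  exists2 r : nat, (r <= n)%N &
    (m - 1) * (s - n%:R * lam) = - r%:R * (s + (m - n%:R) * lam).
Proof.
move=> Wx ux crit; have m0 : m != 0 by rewrite gt_eqF // (lt_trans ltr01).
have m1 : m - 1 != 0 by rewrite subr_eq0 gt_eqF.
have hess_crit a b : Hx x a b = eval x (d a (d b u)).
  rewrite !mxE /hess evalD evalN eval_sum big1 ?oppr0 ?addr0 // => e _.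
  by rewrite evalM crit mulr0.
pose c := - (s + (m - n%:R) * lam).
have E a b : m * (m - 1) * (\sum_k eval x (K a k) * eval x (d b (d k u))) =
    c * (u x * eval x (d b (d a u))).
  have dm : d b (cs m * (cs m - 1)) = 0.
    by rewrite dM (derB dD) der_cst (der1 dM) subrr mul0r mulr0 addr0.
  have dc : d b (- (sA + (cs m - n%:R) * cs lam)) = 0.
    rewrite (derN dD) dD der_scal dM (derB dD) !der_cst (der_nat dD dM).
    by rewrite subrr mul0r mulr0 !addr0 oppr0.
  (* Differentiate [smooth_hess_grad] in direction [b]: at [x] only the terms in which du itself is
     differentiated survive. *)
  have : eval x (d b (cs m * (cs m - 1) * \sum_k K a k * d k u)) =
      eval x (d b (- (sA + (cs m - n%:R) * cs lam) * (u * d a u))).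
    by rewrite smooth_hess_grad.
  rewrite (dM b (_ * _)) dm mul0r add0r (dM b (- _)) dc mul0r add0r.
  rewrite (der_sum dD) (dM b u) !evalE eval_sum eval_scal // crit mul0r add0r => H.
  rewrite -[RHS]H; congr (_ * _).
  by apply: eq_bigr => k _; rewrite dM evalD !evalM crit mulr0 add0r.
pose k := c * u x / (m * (m - 1)).
have KH : Kx x *m Hx x = k *: Hx x.
  apply/matrixP => a b; rewrite [RHS]mxE [LHS]mxE.
  apply: (mulfI (mulf_neq0 m0 m1)).
  rewrite [RHS](_ : _ = c * (u x * Hx x a b)); last by rewrite /k; field; rewrite m0 m1.
  rewrite [Hx x a b]hess_crit dC -E; congr (_ * _).
  by apply: eq_bigr => e _; rewrite [Hx x e b]hess_crit dC [Kx x _ _]mxE [in LHS]mxE.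
have KK : Kx x *m Kx x = k *: Kx x.
  by rewrite {2}KxE mulmxA KH -scalemxAl -KxE.
have := trace_quasi_idempotent KK.
have := congr1 (eval x) smooth_laplacian.
rewrite !evalE eval_scal // eval_sum => H trK.
exists (\rank (Kx x)); first exact: rank_leq_row.
(* Both expressions for the trace contain the factor [u x], which cancels. *)
apply: (mulfI ux); rewrite mulrCA -[u x * _]H.
have -> : \sum_i eval x (K i i) = \tr (Kx x).
  by apply: eq_bigr => i _; rewrite !mxE.
by rewrite trK /k /c; field; rewrite m0 m1.
Qed.

Lemma einstein_constant_eq0 x : W x -> u x != 0 -> s = n%:R * lam ->
  ~ (forall a, eval x (d a u) = 0) -> lam = 0.
Proof.
move=> Wx ux sE ncrit; have m0 : m != 0 by rewrite gt_eqF // (lt_trans ltr01).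
have m1 : m - 1 != 0 by rewrite subr_eq0 gt_eqF.
have csM (r : R) (f : A) y : r != 0 -> (cs r * f) y = 0 -> f y = 0.
  by move=> r0 /eqP; rewrite -[_ y]/(r * f y) mulf_eq0 (negPf r0) => /eqP.
have tr0 : \sum_c K c c = 0.
  apply: smooth_ext => y Wy; apply: (csM m) => //; rewrite smooth_laplacian.
    rewrite -[LHS]/(eval y _) !evalE eval_scal //.
    by rewrite sE subrr mulr0.
  by rewrite -[LHS]/(eval y _) evalM [eval y u]u_off // mul0r.
(* For [s = n lam] the factors in [smooth_ric_grad] and [smooth_hess_grad] reduce to this same
   constant, as [hess_sqnorm] requires. *)
pose k := - lam / (m - 1).
have doff y a f : ~ W y -> eval y (d a f) = 0 by move=> Wy; exact: der_off.
have rick a : \sum_c q a c * d c u = cs k * d a u.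
  apply: smooth_ext => y Wy; rewrite -[LHS]/(eval y _) -[RHS]/(eval y _); last first.
    by rewrite evalM doff // mulr0 eval_sum big1 // => c _; rewrite evalM doff // mulr0.
  have := congr1 (eval y) (smooth_ric_grad a).
  rewrite !evalE eval_scal // => H; apply: (mulfI m1); rewrite H sE /k; field.
  by rewrite m1.
have hessk a : \sum_c K a c * d c u = cs k * u * d a u.
  apply: smooth_ext => y Wy; rewrite -[LHS]/(eval y _) -[RHS]/(eval y _); last first.
    by rewrite evalM doff // mulr0 eval_sum big1 // => c _; rewrite evalM doff // mulr0.
  have := congr1 (eval y) (smooth_hess_grad a).
  rewrite !evalE eval_scal // => H.
  apply: (mulfI (mulf_neq0 m0 m1)); rewrite H sE /k; field.
  by rewrite m1.
have := hess_sqnorm dD dM dC tf hs dh (fun a => der_cst oW a k) tr0 rick hessk.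
move=> /(congr1 (eval x)); rewrite eval_sum => H.
have H0 : Hx x = 0.
  apply: (selfadjoint_trace_sqr_eq0 (h_pos Wx) (Hx_sym x)).
  rewrite -KxE -[RHS]H; apply: eq_bigr => a _; rewrite mxE eval_sum.
  by apply: eq_bigr => c _; rewrite evalM; congr (_ * _); rewrite mxE mxE.
have K0 a c : eval x (K a c) = 0.
  have := KxE x; rewrite H0 mul0mx => /matrixP/(_ a c).
  by rewrite [RHS]mxE => <-; rewrite !mxE.
(* With [K = 0] the eigenvector equation reads [k u du = 0]; if [lam], hence [k], were nonzero, du
   would vanish at [x]. *)
apply: contrapT => lam0; apply: ncrit => a.
have := congr1 (eval x) (hessk a); rewrite eval_sum big1 => [/esym/eqP|c _]; last first.
  by rewrite evalM K0 mul0r.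
rewrite !evalE !mulf_eq0 -[eval x u]/(u x) (negPf ux) orbF.
by rewrite /k oppr_eq0 invr_eq0 (negPf m1) orbF; move/eqP: lam0 => /negPf -> /eqP.
Qed.

End LocalQuasiEinstein.

(** * Charts *)

Section Chart.
Variables (R : realType) (n : nat) (M : topologicalType) (A : smooth_manifold R n M).
Variables (g : riemannian_metric A) (i : idx A) (W : set 'rV[R]_n) (oW : open W).
Hypothesis WD : W `<=` chart_image i.
Local Notation S := (smooth_fun oW).
Local Notation d := (@der R n W oW).

Lemma partial_eval a (f : 'rV[R]_n -> R) (F : S) x :
  (forall y, W y -> f y = F y) -> W x -> partial (chart_image i) a f x = eval x (d a F).
Proof.
move=> fF Wx; rewrite (partialE a f oW WD Wx) /eval derE //; apply: near_eq_derive.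
by near=> y; apply: fF; near: y; exact: open_nbhs_nbhs.
Unshelve. all: by end_near. Qed.

(** The identity matrix is used off [W], which keeps the metric symmetric and invertible at every
    point. *)
Definition chart_metric : 'M[S]_n := \matrix_(a, b)
  extend oW ((a == b)%:R : R) (smooth_on_in (@metric_smooth _ _ _ _ g i a b) oW WD).

Lemma chart_metricE x : W x -> map_mx (eval x) chart_metric = g i x.
Proof. by move=> Wx; apply/matrixP => a b; rewrite !mxE /eval extendE. Qed.

Lemma chart_metric_off x : ~ W x -> map_mx (eval x) chart_metric = 1%:M.
Proof. by move=> Wx; apply/matrixP => a b; rewrite !mxE /eval extend_off. Qed.

Lemma chart_posdef x : W x -> posdef (g i x).
Proof.
by move=> /WD Dx; split; [exact: metric_sym|exact: metric_pos].
Qed.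

Lemma chart_metric_sym : chart_metric^T = chart_metric.
Proof.
apply/matrixP => a b; apply: smooth_ext => x Wx.
  have /matrixP/(_ a b) := (chart_posdef Wx).1; rewrite -chart_metricE //.
  by rewrite !mxE.
have /matrixP/(_ a b) : (map_mx (eval x) chart_metric)^T = map_mx (eval x) chart_metric.
  by rewrite chart_metric_off // trmx1.
by rewrite !mxE.
Qed.

Lemma chart_metric_inv : exists h : 'M[S]_n, chart_metric *m h = 1%:M.
Proof.
apply: smooth_mx_inv => x; case: (pselect (W x)) => Wx.
  by rewrite chart_metricE //; apply: posdef_unit; apply: chart_posdef.
by rewrite chart_metric_off // unitmx1.
Qed.

Variable h : 'M[S]_n.
Hypothesis gh : chart_metric *m h = 1%:M.

Lemma chart_invmx x : W x -> map_mx (eval x) h = invmx (g i x).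
Proof.
move=> Wx; have ug := posdef_unit (chart_posdef Wx).
have : g i x *m map_mx (eval x) h = 1%:M.
  by rewrite -(chart_metricE Wx) -map_mxM gh map_mx1.
by move=> /(congr1 (mulmx (invmx (g i x)))); rewrite mulKmx // mulmx1.
Qed.

Local Notation Gam := (gamma chart_metric h).

Lemma christoffelE c a b x : W x -> christoffel g i c a b x = eval x (Gam a c b).
Proof.
move=> Wx; rewrite /gamma mxE evalE /christoffel eval_sum; congr (_ * _).
apply: eq_bigr => e _; rewrite -chart_invmx // mxE !evalE.
have P k p q : partial (chart_image i) k (fun y => g i y p q) x =
    eval x (d k (chart_metric p q)).
  by apply: partial_eval => // y Wy; rewrite -(chart_metricE Wy) mxE.
by rewrite !P.
Qed.

Lemma riemannE a b c e x : W x -> riemann g i a b c e x = eval x (curv d Gam a b e c).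
Proof.
move=> Wx; have P k p q r : partial (chart_image i) k (christoffel g i p q r) x =
    eval x (d k (Gam q p r)).
  by apply: partial_eval => // y Wy; exact: christoffelE.
rewrite /riemann !P curvE 2!evalD evalN eval_sum.
congr (_ + _); apply: eq_bigr => f _.
by rewrite evalD evalN 2!evalM !christoffelE.
Qed.

Lemma ricciE a b x : W x -> ricci g i x a b = eval x (ricci_mx chart_metric h a b).
Proof.
move=> Wx; rewrite !mxE eval_sum; apply: eq_bigr => c _; exact: riemannE.
Qed.

Variable u : M -> R.
Hypothesis us : smooth_function A u.

(** The value 0 off [W] is what makes the quasi-Einstein equation hold there trivially. *)
Definition chart_fun : S := extend oW 0 (smooth_on_in (@us i) oW WD).

Lemma chart_fun_der a x : W x ->
  eval x (d a chart_fun) = 'D_(basis_vector R a) (u \o param A i) x.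
Proof.
move=> Wx; rewrite /eval derE //; apply: near_eq_derive.
near=> y; rewrite /chart_fun extendE //.
by near: y; exact: open_nbhs_nbhs.
Unshelve. all: by end_near. Qed.

Lemma hessianE a b x : W x ->
  hessian g u i x a b = eval x (hess d Gam chart_fun a b).
Proof.
have P c y : W y -> partial (chart_image i) c (u \o param A i) y = eval y (d c chart_fun).
  by move=> Wy; apply: partial_eval => // z Wz; rewrite /chart_fun extendE.
move=> Wx; rewrite mxE /hess evalD evalN; congr (_ - _).
  by apply: partial_eval => // y Wy; exact: P.
by rewrite eval_sum; apply: eq_bigr => c _; rewrite evalM P // christoffelE.
Qed.
End Chart.

(** * The pointwise results read in a chart *)

Section ChartQuasiEinstein.
Variables (R : realType) (n : nat) (M : topologicalType) (A : smooth_manifold R n M).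
Variables (g : riemannian_metric A) (m : R) (u : M -> R) (lambda s : R).
Hypotheses (qe : quasi_einstein g m u lambda) (m_gt1 : 1 < m).
Hypothesis const_scal : has_constant_scalar_curvature g s.
Variables (i : idx A) (W : set 'rV[R]_n).
Hypotheses (oW : open W) (WD : W `<=` chart_image i).
Local Notation ui := (u \o param A i).
Local Notation D a x := (derive ui x (basis_vector R a)).

Let m0 : m != 0. Proof. by rewrite gt_eqF // (lt_trans ltr01). Qed.
Let us : smooth_function A u. Proof. by case: qe. Qed.
Let gA := chart_metric g oW WD.
Let uA := chart_fun oW WD us.

Let qeA (h : 'M[smooth_fun oW]_n) : gA *m h = 1%:M -> forall x a b, W x ->
  m * eval x (hess (@der R n W oW) (gamma gA h) uA a b) =
  uA x * (eval x (ricci_mx gA h a b) - lambda * eval x (gA a b)).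
Proof.
move=> gh x a b Wx; rewrite -(hessianE gh) // -(ricciE gh) //.
have gAx : eval x (gA a b) = g i x a b by rewrite -(chart_metricE g oW WD Wx) [RHS]mxE.
rewrite gAx; have -> : uA x = ui x by exact: extendE.
have [p ip <-] := WD Wx.
have [_ _ H _ _] := qe; rewrite H // !mxE /= coordK //.
by field.
Qed.

Let scalA (h : 'M[smooth_fun oW]_n) : gA *m h = 1%:M -> forall x, W x ->
  \sum_a \sum_b eval x (h a b) * eval x (ricci_mx gA h a b) = s.
Proof.
move=> gh x Wx; have [p ip px] := WD Wx.
rewrite -(const_scal ip) px /scalar_curvature /metric_trace.
apply: eq_bigr => a _; apply: eq_bigr => b _.
by rewrite -(chart_invmx gh) // (ricciE gh) // [in RHS]mxE.
Qed.

Let u_off x : ~ W x -> uA x = 0.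
Proof. exact: extend_off. Qed.

Let h_pos (h : 'M[smooth_fun oW]_n) : gA *m h = 1%:M -> forall x, W x -> posdef (map_mx (eval x) h).
Proof.
by move=> gh x Wx; rewrite (chart_invmx gh) //; apply/posdef_inv/(chart_posdef g WD).
Qed.

Let uAE x : W x -> uA x = ui x.
Proof. exact: extendE. Qed.

Lemma chart_critical_point x : W x -> ui x != 0 -> (forall a, D a x = 0) ->
  exists2 r : nat, (r <= n)%N &
    (m - 1) * (s - n%:R * lambda) = - r%:R * (s + (m - n%:R) * lambda).
Proof.
move=> Wx ux crit; have [h gh] := chart_metric_inv g oW WD.
apply: (critical_point (chart_metric_sym g oW WD) gh m_gt1 u_off (qeA gh) (scalA gh) Wx).
  by rewrite uAE.
by move=> a; rewrite chart_fun_der.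
Qed.

Lemma chart_einstein x : W x -> ui x != 0 -> s = n%:R * lambda ->
  ~ (forall a, D a x = 0) -> lambda = 0.
Proof.
move=> Wx ux sE ncrit; have [h gh] := chart_metric_inv g oW WD.
apply: (einstein_constant_eq0 (chart_metric_sym g oW WD) gh m_gt1 u_off (h_pos gh)
  (qeA gh) (scalA gh) Wx) => //; first by rewrite uAE.
by move=> H; apply: ncrit => a; rewrite -(chart_fun_der oW WD us).
Qed.
End ChartQuasiEinstein.

(** * Global arguments *)

Lemma derive_local_min (R : realType) n (W : set 'rV[R]_n) (f : 'rV[R]_n -> R) x v :
  open W -> W x -> (forall y, W y -> differentiable f y) ->
  (forall y, W y -> f x <= f y) -> 'D_v f x = 0.
Proof.
move=> oW Wx df fmin.
have nW : nbhs x W by exact: open_nbhs_nbhs.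
have [e e0 We] : exists2 e : R, 0 < e & forall t : R, `|t| < e -> W (x + t *: v).
  (* The parallelogram spanned by [v] and [-v] covers the increments of both signs. *)
  have [e e0 He] := near_parallelogram v (- v) nW.
  exists e => // t; rewrite ltr_norml => /andP[t1 t2].
  case: (leP 0 t) => t0.
    have := He t 0; rewrite scale0r addr0; apply; rewrite ?lexx ?(ltW e0) //.
    by rewrite t0 ltW.
  have := He 0 (- t); rewrite scale0r addr0 scalerN scaleNr opprK; apply.
    by rewrite ?lexx ?(ltW e0).
  by rewrite oppr_ge0 (ltW t0) /= lerNl ltW.
have dline (t : R) : t \in `](- e), e[%R ->
    is_derive t (1 : R) (fun s : R => f (x + s *: v)) ('D_v f (x + t *: v)).
  rewrite in_itv /= => te; apply: is_derive_line; apply: df; apply: We.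
  by rewrite ltr_norml.
have i0 : (0 : R) \in `](- e), e[%R by rewrite in_itv /= e0 oppr_lt0 e0.
have d0 := dline _ i0.
have [] := @derive1_at_min R (fun s : R => f (x + s *: v)) (- e) e 0.
- by rewrite ge0_cp // ltW.
- by move=> t /dline ?; exact: ex_derive.
- exact: i0.
- move=> t; rewrite in_itv /= => te; rewrite scale0r addr0; apply: fmin; apply: We.
  by rewrite ltr_norml.
move=> _ E; have [_] := d0; rewrite scale0r addr0 => <-; exact: E.
Qed.

Lemma derive_local_max (R : realType) n (W : set 'rV[R]_n) (f : 'rV[R]_n -> R) x v :
  open W -> W x -> (forall y, W y -> differentiable f y) ->
  (forall y, W y -> f y <= f x) -> 'D_v f x = 0.
Proof.
move=> oW Wx df fmax; apply/eqP; rewrite -oppr_eq0 -deriveN; last first.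
  by apply: diff_derivable; exact: df.
apply/eqP/(derive_local_min v oW Wx) => [y Wy|y Wy]; last by rewrite lerN2 fmax.
by apply: differentiableN; exact: df.
Qed.

(** * Interior points, boundary points and continuity *)

Section Manifold.
Variables (R : realType) (n : nat) (M : topologicalType) (A : smooth_manifold R n M).
Hypothesis n_gt0 : (0 < n)%N.

Definition chart_interior (i : idx A) : set 'rV[R]_n :=
  chart_image i `&` [set x | forall a : 'I_n, val a = 0%N -> 0 < x 0 a].

Lemma chart_interior_sub i : chart_interior i `<=` chart_image i.
Proof. by move=> x []. Qed.

Lemma chart_interior_open i : open (chart_interior i).
Proof.
have [U oU UE] := coord_image i; pose a0 := Ordinal n_gt0.
have -> : chart_interior i = U `&` ((fun x : 'rV[R]_n => x 0 a0) @^-1` [set t | 0 < t]).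
  apply/seteqP; rewrite /chart_interior /chart_image UE; split=> x [].
    by move=> [Ux _] H; split=> //; exact: H.
  move=> Ux /= x0.
  have H (a : 'I_n) : val a = 0%N -> 0 < x 0 a.
    by move=> a0E; rewrite (_ : a = a0) //; apply: val_inj.
  by split=> //; split=> // a /H /ltW.
apply: openI => //; apply: open_comp; last exact: open_gt.
by move=> x _; apply: differentiable_continuous; exact: differentiable_coord.
Qed.

Lemma param_continuous_interior i x : chart_interior i x -> {for x, continuous (param A i)}.
Proof.
move=> ix; have /continuous_open_subspace := @chart_interior_open i.
move=> /(_ M (param A i)) E.
have : {within chart_interior i, continuous (param A i)}.
  apply: continuous_subspaceW (@param_continuous _ _ _ A i); exact: chart_interior_sub.
by rewrite E; apply; rewrite inE.
Qed.

Lemma transition_dom_open i j :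
  open (chart_interior i `&` [set x | dom A j (param A i x)]).
Proof.
rewrite openE => x [ix jx]; apply: filterI.
  by apply: open_nbhs_nbhs; split=> //; exact: chart_interior_open.
apply: (param_continuous_interior ix).
by apply: open_nbhs_nbhs; split=> //; exact: dom_open.
Qed.

Lemma param_dom i x : chart_image i x -> dom A i (param A i x) /\ coord A i (param A i x) = x.
Proof. by move=> [p ip <-]; rewrite coordK. Qed.

(* A point that lies on the boundary in one chart and in the interior in another
   is a minimum of the first coordinate of the transition map, whose Jacobian
   would then have a zero column; but it relates two positive definite matrices. *)
Lemma param_interior (g : riemannian_metric A) i x :
  chart_interior i x -> minterior A (param A i x).
Proof.
move=> ix [j jp [b b0 pb]].
have [ip px] := param_dom ix.1.
pose T := coord A i @` (dom A i `&` dom A j).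
pose W := chart_interior i `&` [set y | dom A j (param A i y)].
have oW : open W by exact: transition_dom_open.
have WT : W `<=` T.
  by move=> y [iy jy]; have [ipy py] := param_dom iy.1; exists (param A i y).
have Wx : W x by [].
pose f y := coord A j (param A i y) 0 b.
have fs : smooth_in W f := smooth_on_in (@transition_smooth _ _ _ A i j b) oW WT.
have Jb : col b (transition_jacobian i j x) = 0.
  apply/matrixP => a k; rewrite !mxE (partialE a f oW WT Wx).
  apply: (derive_local_min _ oW Wx) => [y Wy|y [_ jy]].
    exact: smooth_in_differentiable fs Wy.
  rewrite /f pb; have [U _ UE] := coord_image j.
  have : chart_image j (coord A j (param A i y)) by exists (param A i y).
  by rewrite /chart_image UE => -[_]; apply.
have pg : posdef (g i x).
  by split; [apply: metric_sym ix.1|apply: metric_pos ix.1].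
have := posdef_unit pg; rewrite -{1}px (metric_change g ip jp) px.
rewrite !unitmx_mul => /andP[/andP[uJ _] _].
have : delta_mx b (0 : 'I_1) = 0 :> 'cV[R]_n.
  by rewrite -[LHS](mulKmx uJ) -colE Jb mulmx0.
move=> /matrixP/(_ b 0); rewrite !mxE !eqxx => /eqP.
by rewrite oner_eq0.
Qed.

Lemma coord_interior (u : M -> R) i p : (forall p, mboundary A p -> u p = 0) ->
  dom A i p -> u p != 0 -> chart_interior i (coord A i p).
Proof.
move=> ub ip up; split=> [|a a0]; first by exists p.
have [U _ UE] := coord_image i.
have : chart_image i (coord A i p) by exists p.
rewrite /chart_image UE => -[_ /(_ a a0)]; rewrite le_eqVlt => /orP[/eqP pa|//].
by case/eqP: up; apply: ub; exists i => //; exists a.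
Qed.

(** Near each point, including boundary points, [u] is the composite of a chart with a
    differentiable function on an open set of R^n. *)
Lemma smooth_function_continuous (u : M -> R) : smooth_function A u -> continuous u.
Proof.
move=> us p; have [i ip] := dom_cover A p.
have Dp : chart_image i (coord A i p) by exists p.
have [W [F [oW Wp dF FE]]] := us i _ Dp.
have cp : {for p, continuous (coord A i)}.
  have := @coord_continuous _ _ _ A i.
  by rewrite (continuous_open_subspace _ (dom_open i)); apply; rewrite inE.
have cF : {for p, continuous (F \o coord A i)}.
  apply: continuous_comp => //; apply: differentiable_continuous.
  exact: (dF [::]).
have nuF : \forall q \near p, F (coord A i q) = u q.
  have n1 : nbhs p (dom A i) by apply: open_nbhs_nbhs; split=> //; exact: dom_open.
  have n2 : nbhs p (coord A i @^-1` W).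
    by apply: cp; apply: open_nbhs_nbhs.
  apply: filterS2 n1 n2 => q iq Wq; rewrite FE //; last by exists q.
  by rewrite /= coordK.
have up : u p = (F \o coord A i) p by rewrite /= (nbhs_singleton nuF).
rewrite /continuous_at up; apply: cvg_trans cF.
apply: near_eq_cvg; apply: filterS nuF => q /= <-; by [].
Qed.

End Manifold.

(** * A noncritical interior point near the boundary *)

Section Boundary.
Variables (R : realType) (n : nat) (M : topologicalType) (A : smooth_manifold R n M).
Variables (g : riemannian_metric A) (u : M -> R).
Hypotheses (n_gt0 : (0 < n)%N) (us : smooth_function A u).
Hypothesis u_int : forall p, minterior A p -> 0 < u p.
Hypothesis u_bd : forall p, mboundary A p -> u p = 0.

(** Move inwards from a boundary point along the normal coordinate. By the mean value theorem, a
    zero derivative at the intermediate point would give [u] the value 0 at an interior point. *)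
Lemma noncritical_near_boundary : mboundary A !=set0 -> exists (i : idx A) x (a : 'I_n),
  chart_interior i x /\ 'D_(basis_vector R a) (u \o param A i) x != 0.
Proof.
move=> [p bp]; have up := u_bd bp; have [i ip [a a0 pa]] := bp.
pose x := coord A i p; pose e := basis_vector R a.
have Dx : chart_image i x by exists p.
have [W [F [oW Wx dF FE]]] := us Dx.
have [U oU UE] := coord_image i.
have Ux : U x by move: Dx; rewrite /chart_image UE => -[].
have nUW : nbhs x (U `&` W) by apply: open_nbhs_nbhs; split=> //; exact: openI.
(* With second vector 0 the parallelogram is a segment from [x]. *)
have [t t0 Ht] := near_parallelogram e 0 nUW.
have {}Ht r : 0 <= r <= t -> (U `&` W) (x + r *: e).
  by move=> rt; have := Ht r 0 rt; rewrite scale0r addr0; apply; rewrite lexx ltW.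
have eE (r : R) b : (x + r *: e) 0 b = x 0 b + r * (b == a)%:R.
  by rewrite !mxE eqxx.
have xa : x 0 a = 0 by [].
have hx : halfspace x by move: Dx; rewrite /chart_image UE => -[].
have int r : 0 < r <= t -> chart_interior i (x + r *: e).
  move=> /andP[r0 rt]; have H b : val b = 0%N -> 0 < (x + r *: e) 0 b.
    by move=> b0; rewrite eE (_ : b = a) ?eqxx ?xa ?mulr1 ?add0r //; apply: val_inj; rewrite b0.
  split=> //; rewrite /chart_image UE; split; last by move=> b /H /ltW.
  by have [] := Ht r; rewrite ?(ltW r0).
pose dphi r := 'D_e F (x + r *: e).
have dline (r : R) : 0 <= r <= t -> is_derive r (1 : R) (fun s => F (x + s *: e)) (dphi r).
  by move=> rt; apply: is_derive_line; apply: (dF [::]); have [] := Ht r rt.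
have [||r rt E] := @MVT _ (fun s => F (x + s *: e)) dphi 0 t t0.
- by move=> r; rewrite in_itv /= => /andP[/ltW r0 /ltW rt]; apply: dline; rewrite r0.
- apply: derivable_within_continuous => r; rewrite in_itv /= => /dline.
  by move=> ?; exact: ex_derive.
have {rt} /andP[r0 rt] : 0 < r < t by move: rt; rewrite in_itv.
have intr : chart_interior i (x + r *: e) by apply: int; rewrite r0 ltW.
exists i, (x + r *: e), a; split=> //.
have Wr : W (x + r *: e) by have [] := Ht r; rewrite ?(ltW r0) ?(ltW rt).
have -> : 'D_(basis_vector R a) (u \o param A i) (x + r *: e) = dphi r.
  apply: near_eq_derive.
  have n1 : nbhs (x + r *: e) W by exact: open_nbhs_nbhs.
  have n2 : nbhs (x + r *: e) (chart_interior i).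
    by apply: open_nbhs_nbhs; split=> //; exact: chart_interior_open.
  by apply: filterS2 n1 n2 => y Wy [Dy _]; rewrite FE.
apply: contraTneq isT => d0.
have tt : chart_interior i (x + t *: e) by apply: int; rewrite t0 lexx.
have Wt : W (x + t *: e) by have [] := Ht t; rewrite ?(ltW t0) ?lexx.
have := u_int (param_interior n_gt0 g tt).
move: E; rewrite d0 mul0r scale0r addr0 FE //; last exact: tt.1.
rewrite FE // /= coordK // up subr0 => ->.
by rewrite ltxx.
Qed.
End Boundary.

Theorem theorem1 (R : realType) (n : nat) (M : topologicalType)
    (A : smooth_manifold R n M) (g : riemannian_metric A)
    (m : R) (u : M -> R) (lambda : R) (S : R)
    (n_ge2 : (2 <= n)%N)
    (qe : quasi_einstein g m u lambda)
    (nontrivial : ~ trivial_potential u)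
    (with_boundary : mboundary A !=set0)
    (m_gt1 : 1 < m)
    (const_scal : has_constant_scalar_curvature g S) :
  S \in [set ((k%:R * (m - n%:R) + n%:R * (n%:R - 1))
              / (m + n%:R - k%:R - 1)) * lambda
        | k in [set k : nat | (k < n)%N]].
Proof.
have n0 : (0 < n)%N by exact: ltnW.
have [[cM _] us _ [u_int u_bd] _] := qe.
have [i0 [x0 [a [ix0 du0]]]] := noncritical_near_boundary g n0 us u_int u_bd with_boundary.
have u0 : 0 < u (param A i0 x0) by apply: u_int; exact: param_interior.
have M0 : [set: M] !=set0 by exists (param A i0 x0).
have [|q _ qmax] := compact_EVT_max (f := u) M0 cM.
  by apply: continuous_subspaceT; exact: smooth_function_continuous.
have uq : 0 < u q by apply: lt_le_trans u0 (qmax _ _); rewrite inE.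
have [i iq] := dom_cover A q.
have uq0 : u q != 0 by rewrite gt_eqF.
(* The maximum is positive, so it is attained away from the boundary and is a critical point in a
   chart. *)
have xq := coord_interior u_bd iq uq0.
have oW := chart_interior_open n0 (i := i).
have [r rn] : exists2 r : nat, (r <= n)%N &
    (m - 1) * (S - n%:R * lambda) = - r%:R * (S + (m - n%:R) * lambda).
  apply: (chart_critical_point qe m_gt1 const_scal oW (@chart_interior_sub _ _ _ _ i) xq).
    by rewrite /= coordK.
  move=> b; apply: (derive_local_max _ oW xq) => [y Wy|y Wy].
    apply: smooth_in_differentiable Wy.
    by apply: smooth_on_in oW _; [exact: us|exact: chart_interior_sub].
  by rewrite /= coordK //; apply: qmax; rewrite inE.
have m1 : 0 < m - 1 by rewrite subr_gt0.
(* Rank 0 forces [S = n lambda] and then [lambda = 0], so that [S = 0] is the value at k = 0. For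
   positive rank r the index is k = n - r, which is less than n. *)
case: r rn => [|r] rn E; rewrite inE /=.
  have SE : S = n%:R * lambda.
    apply/eqP; rewrite -subr_eq0; move: E; rewrite oppr0 mul0r => /eqP.
    by rewrite mulf_eq0 (gt_eqF m1).
  have l0 : lambda = 0.
    have oW0 := chart_interior_open n0 (i := i0).
    apply: (chart_einstein qe m_gt1 const_scal oW0 (@chart_interior_sub _ _ _ _ i0) ix0 _ SE).
      by rewrite /= gt_eqF.
    by move=> /(_ a) /eqP; apply/negP.
  by exists 0%N => //; rewrite SE l0 !mulr0.
exists (n - r.+1)%N; first by rewrite /= ltn_subrL.
have r0 : 0 < m - 1 + r.+1%:R by rewrite ltr_wpDr.
rewrite natrB //.
(* For k = n - r the denominator is m - 1 + r, positive because m > 1. *)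
have den : m + n%:R - (n%:R - r.+1%:R) - 1 = m - 1 + r.+1%:R by ring.
rewrite den; apply: (mulIf (lt0r_neq0 r0)).
rewrite mulrAC divfK ?lt0r_neq0 //; lra.
Qed.
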